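(* Let $f,g\in H^2_\tau(\mathcal S)$ be such that $|g(x)|=|f(x)|$ for all $x\in\mathbb R$ and $$|g(z)|=|f(z)|\qquad\text{for all } z \text{ in the open segment } (a-e^{i\theta},\,a+e^{i\theta})=\{a+te^{i\theta}: t\in(-1,1)\},$$ where $a\in\mathbb R$ and $\theta\notin\pi\mathbb Q$. Then $g=cf$ for some constant $c\in\mathbb C$ with $|c|=1$.
   Context: $\mathcal S=\{z\in\mathbb C:|\mathrm{Im}\,z|<1\}$ is the strip, and $H^2_\tau(\mathcal S)$ is the space of holomorphic functions $f$ on $\mathcal S$ with $\sup_{|y|<1}\int_{\mathbb R}|f(t+iy)|^2\,\mathrm dt<\infty$. *)

(* Defs.v *)
From Stdlib Require Export Reals QArith.
From Coquelicot Require Export Coquelicot.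

Definition in_strip (z : C) : Prop := Rabs (Im z) < 1.

Definition holomorphic_on_strip (f : C -> C) : Prop :=
  forall z : C, in_strip z ->
    exists l : C, is_derive (K := C_AbsRing) (V := C_NormedModule) f z l.

(* sup_{|y|<1} \int_R |f(t+iy)|^2 dt < oo.  For a holomorphic (hence continuous)
   f the integrand is continuous and nonnegative, so the Lebesgue integral over R
   is the supremum over n of the Riemann integrals over [-n, n]. *)
Definition H2_strip_bounded (f : C -> C) : Prop :=
  exists M : R, forall y : R, Rabs y < 1 -> forall n : nat,
    RInt (fun t : R => (Cmod (f (t, y)))^2) (- INR n) (INR n) <= M.

Definition H2tau (f : C -> C) : Prop :=
  holomorphic_on_strip f /\ H2_strip_bounded f.

(* Main.v *)
(* Both functions only matter near [a].  Write [f = A z^m + ...] and [g = B z^m + ...] in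
   [z] centred at [a]; equality of the moduli on the real line forces equal orders and
   [|A| = |B|].  With [c = B/A], suppose [F = g - c f = D z^(m+k) + ...] with [D <> 0], [k >= 1].
   Along a ray [z = t w] with [|w| = 1], the term of order [2m+k] of [|c f + F|^2 - |f|^2] gives
   [Re (conj B * D * w^k) = 0].  For [w = 1] this makes [conj B * D] purely imaginary, and for
   [w = e^(i theta)] it then gives [sin (k theta) = 0], so [theta] is a rational multiple of
   [PI].  Hence [F] vanishes near [a], and on the strip by the identity theorem.

   Taylor expansions come from Cauchy's formula on circles.  It is obtained by applying
   Goursat's theorem to rectangles in the logarithmic coordinate: for [F] holomorphic
   the mean of [F (e^(u+iv))] over a period in [v] does not depend on [u]. *)
Require Import Defs.
From Stdlib Require Import Lra Lia Classical ClassicalEpsilon.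
Open Scope R_scope.

(** In logarithmic coordinates circles become vertical segments, so Goursat is only needed for real
    integrals over rectangles. The price is that the exponential never reaches the centre, and that
    the difference quotient used for Cauchy's formula at [z] is not known to be differentiable at
    [z]. Both gaps are closed by continuity alone: the integrand against the angle carries a factor
    [zeta] and tends to 0 at the centre, and the mean depends continuously on the radius, so it can
    be carried across the circle through [z]. In the final comparison each of the two lines yields
    one real equation for the single complex number [conj B * D]. The order gap [k] cannot be
    controlled, so the two equations have to be independent for every [k >= 1]; this is what the
    irrational angle provides. No asymptotic notation is used: remainders are functions with a
    uniform bound, and each limit becomes an inequality linear in [t]. *)

(** * Goursat's theorem on rectangles *)

Lemma nested_intervals (a b : nat -> R) :
  (forall n, a n <= a (S n)) -> (forall n, b (S n) <= b n) ->
  (forall n, a n <= b n) -> exists p, forall n, a n <= p <= b n.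
Proof.
intros Ha Hb Hab.
assert (Ha' : forall n m, (n <= m)%nat -> a n <= a m).
{ intros n m H; induction H as [|m H IH]; [lra|]. specialize (Ha m); lra. }
assert (Hb' : forall n m, (n <= m)%nat -> b m <= b n).
{ intros n m H; induction H as [|m H IH]; [lra|]. specialize (Hb m); lra. }
destruct (completeness (fun x => exists n, x = a n)) as [p [Hp1 Hp2]].
- exists (b O). intros x [n ->]. specialize (Hab n). specialize (Hb' O n (Nat.le_0_l n)). lra.
- exists (a O). now exists O.
- exists p. intros n. split.
  + apply Hp1. now exists n.
  + apply Hp2. intros x [m ->].
    specialize (Ha' m (max n m) (Nat.le_max_r n m)).
    specialize (Hb' n (max n m) (Nat.le_max_l n m)).
    specialize (Hab (max n m)). lra.
Qed.

(** Bisection in two dimensions: if [Pr] failed on the whole rectangle it would fail on some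
    quarter, and so on down to a point [(p, q)] near which it holds by assumption. All rectangles
    share the proportions [w : h], so a corner and a scale [s] describe them. *)
Lemma quadrisection (Pr : R -> R -> R -> Prop) (w h x0 y0 : R) :
  let sub x y s := x0 <= x /\ x + s * w <= x0 + w /\ y0 <= y /\ y + s * h <= y0 + h in
  0 <= w -> 0 <= h ->
  (forall x y s, 0 < s -> sub x y s ->
     Pr x y (s / 2) -> Pr (x + s / 2 * w) y (s / 2) ->
     Pr x (y + s / 2 * h) (s / 2) -> Pr (x + s / 2 * w) (y + s / 2 * h) (s / 2) ->
     Pr x y s) ->
  (forall p q, x0 <= p <= x0 + w -> y0 <= q <= y0 + h ->
     exists d, 0 < d /\ forall x y s, 0 < s < d -> sub x y s ->
       x <= p <= x + s * w -> y <= q <= y + s * h -> Pr x y s) ->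
  Pr x0 y0 1.
Proof.
intros sub Hw Hh Hsplit Hloc.
apply NNPP; intros Hn.
set (bad n (v : R * R) := sub (fst v) (snd v) (/ 2 ^ n) /\ ~ Pr (fst v) (snd v) (/ 2 ^ n)).
assert (Hpos : forall n, 0 < / 2 ^ n).
{ intros n; apply Rinv_0_lt_compat, pow_lt; lra. }
assert (Hhalf : forall n, / 2 ^ (S n) = / 2 ^ n / 2).
{ intros n; simpl. field. apply pow_nonzero; lra. }
assert (Hstep : forall n v, bad n v -> exists v', bad (S n) v' /\
  fst v <= fst v' /\ fst v' + / 2 ^ (S n) * w <= fst v + / 2 ^ n * w /\
  snd v <= snd v' /\ snd v' + / 2 ^ (S n) * h <= snd v + / 2 ^ n * h).
{ intros n [x y] [Hs Hb]; simpl fst in *; simpl snd in *.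
  apply NNPP; intros Hno. apply Hb.
  unfold bad in Hno; rewrite Hhalf in Hno.
  specialize (Hpos n). set (s := / 2 ^ n) in *.
  assert (0 <= s * w) by (apply Rmult_le_pos; lra).
  assert (0 <= s * h) by (apply Rmult_le_pos; lra).
  destruct Hs as (H1 & H2 & H3 & H4).
  apply Hsplit; [assumption | repeat split; assumption | ..];
    apply NNPP; intros Hc; apply Hno.
  - exists (x, y); simpl; unfold sub; repeat split; trivial; lra.
  - exists (x + s / 2 * w, y); simpl; unfold sub; repeat split; trivial; lra.
  - exists (x, y + s / 2 * h); simpl; unfold sub; repeat split; trivial; lra.
  - exists (x + s / 2 * w, y + s / 2 * h); simpl; unfold sub; repeat split; trivial; lra. }
assert (Hbad0 : bad O (x0, y0)).
{ unfold bad, sub; simpl. replace (/ 1) with 1 by field. repeat split; try lra. exact Hn. }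
(* Dependent choice: [Hstep] only asserts that a bad quarter exists, so the sequence carries its
   proofs of badness along. *)
set (next n (u : {v | bad n v}) :=
  let e := constructive_indefinite_description _ (Hstep n (proj1_sig u) (proj2_sig u)) in
  exist (bad (S n)) (proj1_sig e) (proj1 (proj2_sig e))).
set (sq := nat_rect (fun n => {v | bad n v}) (exist _ _ Hbad0) next).
set (v n := proj1_sig (sq n)).
assert (Hv : forall n, bad n (v n)) by (intros n; exact (proj2_sig (sq n))).
assert (Hmon : forall n,
  fst (v n) <= fst (v (S n)) /\ fst (v (S n)) + / 2 ^ (S n) * w <= fst (v n) + / 2 ^ n * w /\
  snd (v n) <= snd (v (S n)) /\ snd (v (S n)) + / 2 ^ (S n) * h <= snd (v n) + / 2 ^ n * h).
{ intros n. unfold v at 2 4 6 8. simpl sq. unfold next. simpl proj1_sig.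
  exact (proj2 (proj2_sig (constructive_indefinite_description _
    (Hstep n (proj1_sig (sq n)) (proj2_sig (sq n)))))). }
destruct (nested_intervals (fun n => fst (v n)) (fun n => fst (v n) + / 2 ^ n * w)) as [p Hp].
{ intros n; apply Hmon. } { intros n; apply Hmon. }
{ intros n. specialize (Hpos n). nra. }
destruct (nested_intervals (fun n => snd (v n)) (fun n => snd (v n) + / 2 ^ n * h)) as [q Hq].
{ intros n; apply Hmon. } { intros n; apply Hmon. }
{ intros n. specialize (Hpos n). nra. }
cbv beta in Hp, Hq.
destruct (Hloc p q) as [d [Hd Hl]].
{ specialize (Hp O). destruct (Hv O) as [(A & B & _) _]. lra. }
{ specialize (Hq O). destruct (Hv O) as [(_ & _ & A & B) _]. lra. }
destruct (pow_lt_1_zero (/2)) with (y := d) as [N HN]; trivial.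
{ rewrite Rabs_pos_eq; lra. }
specialize (HN N (Nat.le_refl N)). rewrite pow_inv in HN.
rewrite Rabs_pos_eq in HN by (left; apply Hpos).
destruct (Hv N) as [Hs Hb]. apply Hb. apply Hl; auto.
Qed.

(** The form is [P dx + Q dy]; the shared [be] expresses equality of the cross derivatives.
    Continuity of the partial derivatives is not demanded, which is why Green's theorem gives way to
    Goursat's argument. *)
Definition closed_form_at (P Q : R -> R -> R) (x y : R) : Prop :=
  exists al be ga, differentiable_pt_lim P x y al be /\ differentiable_pt_lim Q x y be ga.

(** Counterclockwise circulation of [P dx + Q dy]. *)
Definition boundary_integral (P Q : R -> R -> R) (x1 x2 y1 y2 : R) : R :=
  RInt (fun x => P x y1) x1 x2 - RInt (fun x => P x y2) x1 x2 +
  RInt (fun y => Q x2 y) y1 y2 - RInt (fun y => Q x1 y) y1 y2.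

Lemma RInt_near_const (f : R -> R) (a b c M : R) :
  a <= b -> ex_RInt f a b -> (forall t, a <= t <= b -> Rabs (f t - c) <= M) ->
  Rabs (RInt f a b - c * (b - a)) <= (b - a) * M.
Proof.
intros Hab Hex Hb.
replace (RInt f a b - c * (b - a)) with (RInt (fun t => f t - c) a b).
- apply abs_RInt_le_const; trivial.
  apply (ex_RInt_minus (V := R_NormedModule)); trivial. apply ex_RInt_const.
- rewrite (RInt_minus (V := R_CompleteNormedModule) f (fun _ => c)); trivial; [|apply ex_RInt_const].
  rewrite RInt_const. unfold minus, plus, opp, scal; simpl. unfold mult; simpl. ring.
Qed.

Lemma continuity_2d_fst (P : R -> R -> R) x y :
  continuity_2d_pt P x y -> continuous (fun t => P t y) x.
Proof.
intros H. apply continuity_pt_filterlim. intros eps Heps.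
destruct (H (mkposreal eps Heps)) as [d Hd].
exists d. split; [apply cond_pos|]. intros t [_ Ht]. simpl in *. unfold R_dist in *.
apply Hd; trivial. replace (y - y) with 0 by ring. rewrite Rabs_R0. apply cond_pos.
Qed.

Lemma continuity_2d_snd (P : R -> R -> R) x y :
  continuity_2d_pt P x y -> continuous (fun t => P x t) y.
Proof.
intros H. apply (continuity_2d_fst (fun s t => P t s)).
intros eps. destruct (H eps) as [d Hd]. exists d. intros; now apply Hd.
Qed.

Section Goursat.
Variables (P Q : R -> R -> R) (x0 x1 y0 y1 : R).
Hypothesis closed : forall x y, x0 <= x <= x1 -> y0 <= y <= y1 -> closed_form_at P Q x y.

Lemma closed_form_ex_RInt_fst x x' y :
  x0 <= x -> x <= x' -> x' <= x1 -> y0 <= y <= y1 -> ex_RInt (fun t => P t y) x x'.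
Proof.
intros. apply (ex_RInt_continuous (V := R_CompleteNormedModule)). intros t Ht.
rewrite Rmin_left, Rmax_right in Ht by lra.
apply continuity_2d_fst. destruct (closed t y) as (al & be & ga & H3 & _); try lra.
eapply differentiable_continuity_pt. exists al, be. exact H3.
Qed.

Lemma closed_form_ex_RInt_snd x y y' :
  x0 <= x <= x1 -> y0 <= y -> y <= y' -> y' <= y1 -> ex_RInt (fun t => Q x t) y y'.
Proof.
intros. apply (ex_RInt_continuous (V := R_CompleteNormedModule)). intros t Ht.
rewrite Rmin_left, Rmax_right in Ht by lra.
apply continuity_2d_snd. destruct (closed x t) as (al & be & ga & _ & H3); try lra.
eapply differentiable_continuity_pt. exists be, ga. exact H3.
Qed.

Lemma boundary_integral_quarters x x' x'' y y' y'' :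
  x0 <= x -> x <= x' -> x' <= x'' -> x'' <= x1 -> y0 <= y -> y <= y' -> y' <= y'' -> y'' <= y1 ->
  boundary_integral P Q x x'' y y'' =
  boundary_integral P Q x x' y y' + boundary_integral P Q x' x'' y y' +
  boundary_integral P Q x x' y' y'' + boundary_integral P Q x' x'' y' y''.
Proof.
intros. unfold boundary_integral.
assert (HP : forall t, y0 <= t <= y1 ->
  RInt (fun s => P s t) x x'' = RInt (fun s => P s t) x x' + RInt (fun s => P s t) x' x'').
{ intros t Ht. symmetry. apply (RInt_Chasles (V := R_CompleteNormedModule));
  apply closed_form_ex_RInt_fst; lra. }
assert (HQ : forall t, x0 <= t <= x1 ->
  RInt (fun s => Q t s) y y'' = RInt (fun s => Q t s) y y' + RInt (fun s => Q t s) y' y'').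
{ intros t Ht. symmetry. apply (RInt_Chasles (V := R_CompleteNormedModule));
  apply closed_form_ex_RInt_snd; lra. }
rewrite !HP, !HQ by lra. ring.
Qed.

(** Replace [P] and [Q] by their affine approximations at [(p, q)]: the horizontal sides contribute
    [be] times minus the area and the vertical sides [be] times the area, which cancel. Only the
    errors remain, at most [eps / 2 * L] on each side, with [L] the half-perimeter. *)
Lemma boundary_integral_small p q eps :
  x0 <= p <= x1 -> y0 <= q <= y1 -> 0 < eps ->
  exists d, 0 < d /\ forall x x' y y', x0 <= x <= p -> p <= x' <= x1 ->
    y0 <= y <= q -> q <= y' <= y1 -> x' - x < d -> y' - y < d ->
    Rabs (boundary_integral P Q x x' y y') <= eps * ((x' - x) + (y' - y)) ^ 2.
Proof.
intros Hp Hq Heps.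
destruct (closed p q) as (al & be & ga & HP & HQ); trivial.
assert (He : 0 < eps / 2) by lra.
destruct (HP (mkposreal _ He)) as [d1 Hd1].
destruct (HQ (mkposreal _ He)) as [d2 Hd2]. simpl in Hd1, Hd2.
exists (Rmin d1 d2). split; [apply Rmin_pos; apply cond_pos|].
intros x x' y y' Hx Hx' Hy Hy' Hlx Hly.
pose proof (Rmin_l d1 d2). pose proof (Rmin_r d1 d2).
set (L := (x' - x) + (y' - y)).
assert (Habs : forall u v, x <= u <= x' -> y <= v <= y' ->
  Rabs (u - p) < d1 /\ Rabs (u - p) < d2 /\ Rabs (v - q) < d1 /\ Rabs (v - q) < d2 /\
  Rmax (Rabs (u - p)) (Rabs (v - q)) <= L).
{ intros u v Hu Hv. unfold L.
  assert (Rabs (u - p) <= x' - x) by (apply Rabs_le; lra).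
  assert (Rabs (v - q) <= y' - y) by (apply Rabs_le; lra).
  repeat split; try lra. apply Rmax_lub; lra. }
assert (HP' : forall u v, x <= u <= x' -> y <= v <= y' ->
  Rabs (P u v - P p q - (al * (u - p) + be * (v - q))) <= eps / 2 * L).
{ intros u v Hu Hv. destruct (Habs u v Hu Hv) as (A & _ & B & _ & C).
  eapply Rle_trans; [apply Hd1; assumption|]. apply Rmult_le_compat_l; lra. }
assert (HQ' : forall u v, x <= u <= x' -> y <= v <= y' ->
  Rabs (Q u v - Q p q - (be * (u - p) + ga * (v - q))) <= eps / 2 * L).
{ intros u v Hu Hv. destruct (Habs u v Hu Hv) as (_ & A & _ & B & C).
  eapply Rle_trans; [apply Hd2; assumption|]. apply Rmult_le_compat_l; lra. }
assert (H1 : Rabs (RInt (fun t => P t y - P t y') x x' - be * (y - y') * (x' - x))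
  <= (x' - x) * (eps * L)).
{ apply RInt_near_const; [lra| |].
  - apply (ex_RInt_minus (V := R_NormedModule)); apply closed_form_ex_RInt_fst; lra.
  - intros t Ht.
    pose proof (HP' t y Ht ltac:(lra)) as A. pose proof (HP' t y' Ht ltac:(lra)) as B.
    apply Rabs_le_between in A. apply Rabs_le_between in B. apply Rabs_le. lra. }
assert (H2 : Rabs (RInt (fun t => Q x' t - Q x t) y y' - be * (x' - x) * (y' - y))
  <= (y' - y) * (eps * L)).
{ apply RInt_near_const; [lra| |].
  - apply (ex_RInt_minus (V := R_NormedModule)); apply closed_form_ex_RInt_snd; lra.
  - intros t Ht.
    pose proof (HQ' x t ltac:(lra) Ht) as A. pose proof (HQ' x' t ltac:(lra) Ht) as B.
    apply Rabs_le_between in A. apply Rabs_le_between in B. apply Rabs_le. lra. }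
rewrite (RInt_minus (V := R_CompleteNormedModule) (fun t => P t y) (fun t => P t y')) in H1
  by (apply closed_form_ex_RInt_fst; lra).
rewrite (RInt_minus (V := R_CompleteNormedModule) (fun t => Q x' t) (fun t => Q x t)) in H2
  by (apply closed_form_ex_RInt_snd; lra).
unfold minus, plus, opp in H1, H2; simpl in H1, H2.
unfold boundary_integral.
apply Rabs_le_between in H1. apply Rabs_le_between in H2.
replace (eps * L ^ 2) with ((x' - x) * (eps * L) + (y' - y) * (eps * L)) by (unfold L; ring).
apply Rabs_le. lra.
Qed.

Lemma goursat : x0 <= x1 -> y0 <= y1 -> boundary_integral P Q x0 x1 y0 y1 = 0.
Proof.
intros Hx Hy.
set (w := x1 - x0). set (h := y1 - y0).
assert (key : forall eps, 0 < eps -> Rabs (boundary_integral P Q x0 x1 y0 y1) <= eps * (w + h) ^ 2).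
{ intros eps Heps.
  assert (K : Rabs (boundary_integral P Q x0 (x0 + 1 * w) y0 (y0 + 1 * h)) <= eps * (w + h) ^ 2 * 1 ^ 2).
  (* The bound is quadratic in the scale, so four quarters add up exactly:
     [4 * (s / 2) ^ 2 = s ^ 2]. *)
  { apply (quadrisection (fun x y s =>
      Rabs (boundary_integral P Q x (x + s * w) y (y + s * h)) <= eps * (w + h) ^ 2 * s ^ 2) w h x0 y0);
    [unfold w; lra | unfold h; lra | |].
    - intros x y s Hs (A & B & C & D) H1 H2 H3 H4.
      assert (0 <= s * w) by (apply Rmult_le_pos; unfold w; lra).
      assert (0 <= s * h) by (apply Rmult_le_pos; unfold h; lra).
      rewrite (boundary_integral_quarters x (x + s / 2 * w) (x + s * w) y (y + s / 2 * h) (y + s * h))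
        by (unfold w, h in *; lra).
      replace (x + s / 2 * w + s / 2 * w) with (x + s * w) in * by field.
      replace (y + s / 2 * h + s / 2 * h) with (y + s * h) in * by field.
      replace (eps * (w + h) ^ 2 * s ^ 2) with (4 * (eps * (w + h) ^ 2 * (s / 2) ^ 2)) by field.
      apply Rabs_le_between in H1. apply Rabs_le_between in H2.
      apply Rabs_le_between in H3. apply Rabs_le_between in H4. apply Rabs_le. lra.
    - intros p q Hp Hq.
      destruct (boundary_integral_small p q eps) as [d [Hd Hb]]; trivial;
        [unfold w in *; lra | unfold h in *; lra |].
      (* Makes [s * w] and [s * h] smaller than [d]; the added 1 covers a degenerate rectangle. *)
      exists (d / (w + h + 1)).
      assert (Hwh : 0 < w + h + 1) by (unfold w, h; lra).
      split; [apply Rdiv_lt_0_compat; lra|].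
      intros x y s [Hs Hsd] (A & B & C & D) Hxp Hyq.
      apply (Rmult_lt_compat_r (w + h + 1)) in Hsd; trivial.
      replace (d / (w + h + 1) * (w + h + 1)) with d in Hsd by (field; lra).
      assert (0 <= s * w) by (apply Rmult_le_pos; unfold w; lra).
      assert (0 <= s * h) by (apply Rmult_le_pos; unfold h; lra).
      eapply Rle_trans; [apply Hb; unfold w, h in *; lra|].
      apply Req_le. ring. }
  replace (x0 + 1 * w) with x1 in K by (unfold w; ring).
  replace (y0 + 1 * h) with y1 in K by (unfold h; ring).
  lra. }
set (B := boundary_integral P Q x0 x1 y0 y1) in *.
apply NNPP; intros Hn.
assert (HB : 0 < Rabs B) by now apply Rabs_pos_lt.
assert (0 <= (w + h) ^ 2) by apply pow2_ge_0.
(* With this [eps] the bound reads at most [Rabs B / 2], impossible for nonzero [B]. *)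
specialize (key (Rabs B / (2 * ((w + h) ^ 2 + 1)))).
assert (0 < Rabs B / (2 * ((w + h) ^ 2 + 1))) by (apply Rdiv_lt_0_compat; lra).
specialize (key H0).
assert (Rabs B / (2 * ((w + h) ^ 2 + 1)) * (w + h) ^ 2 <= Rabs B / 2); [|lra].
replace (Rabs B / 2) with (Rabs B / (2 * ((w + h) ^ 2 + 1)) * ((w + h) ^ 2 + 1)) by (field; lra).
apply Rmult_le_compat_l; lra.
Qed.

End Goursat.

(** * Continuity and complex differentiability at a point *)

Definition ccont (f : C -> C) (z : C) : Prop :=
  forall eps, 0 < eps -> exists d, 0 < d /\
    forall w, Cmod (w - z) < d -> Cmod (f w - f z) < eps.

(* Caratheodory's formulation: [phi] is the difference quotient, and its
   continuity at [z] encodes differentiability. *)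
Definition cdiff (f : C -> C) (z : C) : Prop :=
  exists phi, ccont phi z /\ forall w, (f w - f z = phi w * (w - z))%C.

Lemma Cmod_minus_sym (x y : C) : Cmod (x - y) = Cmod (y - x).
Proof. rewrite <- Cmod_opp. f_equal. ring. Qed.

Lemma Cmod_self (z : C) : Cmod (z - z) = 0.
Proof. replace (z - z)%C with (RtoC 0) by ring. apply Cmod_0. Qed.

Lemma Cmod_reverse_triangle (x y : C) : Cmod x - Cmod y <= Cmod (x - y).
Proof.
pose proof (Cmod_triangle (x - y) y) as H.
replace (x - y + y)%C with x in H by ring. lra.
Qed.

Lemma ccont_ext_loc f g z :
  (exists d, 0 < d /\ forall w, Cmod (w - z) < d -> f w = g w) -> ccont g z -> ccont f z.
Proof.
intros [d [Hd Hfg]] Hg eps Heps. destruct (Hg eps Heps) as [d' [Hd' H]].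
exists (Rmin d d'). split; [now apply Rmin_pos|]. intros w Hw.
pose proof (Rmin_l d d'); pose proof (Rmin_r d d').
rewrite !Hfg; [apply H; lra | rewrite Cmod_self; lra | lra].
Qed.

Lemma ccont_const (c z : C) : ccont (fun _ => c) z.
Proof. intros eps He. exists 1. split; [lra|]. intros w _. rewrite Cmod_self. lra. Qed.

Lemma ccont_id (z : C) : ccont (fun w => w) z.
Proof. intros eps He. exists eps. split; [lra|]. now intros. Qed.

Lemma ccont_plus f g z : ccont f z -> ccont g z -> ccont (fun w => f w + g w)%C z.
Proof.
intros Hf Hg eps He.
destruct (Hf (eps / 2) ltac:(lra)) as [d [Hd H]].
destruct (Hg (eps / 2) ltac:(lra)) as [d' [Hd' H']].
exists (Rmin d d'). split; [now apply Rmin_pos|]. intros w Hw.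
pose proof (Rmin_l d d'); pose proof (Rmin_r d d').
specialize (H w ltac:(lra)). specialize (H' w ltac:(lra)).
replace (f w + g w - (f z + g z))%C with ((f w - f z) + (g w - g z))%C by ring.
eapply Rle_lt_trans; [apply Cmod_triangle|]. lra.
Qed.

Lemma ccont_mult f g z : ccont f z -> ccont g z -> ccont (fun w => f w * g w)%C z.
Proof.
intros Hf Hg eps He.
pose proof (Cmod_ge_0 (f z)) as F0. pose proof (Cmod_ge_0 (g z)) as G0.
assert (He1 : 0 < eps / (2 * (Cmod (f z) + 1))) by (apply Rdiv_lt_0_compat; lra).
assert (He2 : 0 < Rmin 1 (eps / (2 * (Cmod (g z) + 1))))
  by (apply Rmin_pos; [lra|apply Rdiv_lt_0_compat; lra]).
destruct (Hg _ He1) as [d' [Hd' H']].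
destruct (Hf _ He2) as [d [Hd H]].
exists (Rmin d d'). split; [now apply Rmin_pos|]. intros w Hw.
pose proof (Rmin_l d d'); pose proof (Rmin_r d d').
specialize (H w ltac:(lra)). specialize (H' w ltac:(lra)).
pose proof (Rmin_l 1 (eps / (2 * (Cmod (g z) + 1)))).
pose proof (Rmin_r 1 (eps / (2 * (Cmod (g z) + 1)))).
replace (f w * g w - (f z * g z))%C with (f w * (g w - g z) + (f w - f z) * g z)%C by ring.
eapply Rle_lt_trans; [apply Cmod_triangle|]. rewrite !Cmod_mult.
assert (Hfw : Cmod (f w) <= Cmod (f z) + 1).
{ pose proof (Cmod_reverse_triangle (f w) (f z)). lra. }
pose proof (Cmod_ge_0 (f w)). pose proof (Cmod_ge_0 (g w - g z)).
pose proof (Cmod_ge_0 (f w - f z)).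
assert (Cmod (f w) * Cmod (g w - g z) < eps / 2).
{ eapply Rle_lt_trans; [apply Rmult_le_compat_r; [lra|apply Hfw]|].
  replace (eps / 2) with ((Cmod (f z) + 1) * (eps / (2 * (Cmod (f z) + 1)))) by (field; lra).
  apply Rmult_lt_compat_l; lra. }
assert (Cmod (f w - f z) * Cmod (g z) <= eps / 2).
{ apply Rle_trans with (eps / (2 * (Cmod (g z) + 1)) * (Cmod (g z) + 1)).
  - apply Rmult_le_compat; lra.
  - apply Req_le. field. lra. }
lra.
Qed.

Lemma ccont_inv (z : C) : z <> 0 -> ccont Cinv z.
Proof.
intros Hz eps He. assert (Hm : 0 < Cmod z) by now apply Cmod_gt_0.
(* The first bound keeps [Cmod w] above [Cmod z / 2]; the second then controls [(z - w) / (w z)]. *)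
exists (Rmin (Cmod z / 2) (eps * (Cmod z * Cmod z) / 2)). split.
{ apply Rmin_pos; [lra|]. assert (0 < eps * (Cmod z * Cmod z)) by (repeat apply Rmult_lt_0_compat; lra). lra. }
intros w Hw.
pose proof (Rmin_l (Cmod z / 2) (eps * (Cmod z * Cmod z) / 2)).
pose proof (Rmin_r (Cmod z / 2) (eps * (Cmod z * Cmod z) / 2)).
pose proof (Cmod_reverse_triangle z w) as Ht. rewrite Cmod_minus_sym in Ht.
assert (Hw2 : Cmod z / 2 < Cmod w) by lra.
assert (Hw0 : w <> 0) by (apply Cmod_gt_0; lra).
replace (/ w - / z)%C with ((z - w) * / (w * z))%C by (field; auto).
rewrite Cmod_mult, Cmod_inv by now apply Cmult_neq_0.
rewrite Cmod_mult, Cmod_minus_sym.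
apply (Rmult_lt_reg_r (Cmod w * Cmod z)); [apply Rmult_lt_0_compat; lra|].
rewrite Rmult_assoc, Rinv_l by (apply Rgt_not_eq, Rmult_lt_0_compat; lra).
assert (eps * (Cmod z / 2 * Cmod z) < eps * (Cmod w * Cmod z)).
{ apply Rmult_lt_compat_l; trivial. apply Rmult_lt_compat_r; lra. }
lra.
Qed.

Lemma ccont_comp f g z : ccont g z -> ccont f (g z) -> ccont (fun w => f (g w)) z.
Proof.
intros Hg Hf eps He. destruct (Hf eps He) as [d [Hd H]].
destruct (Hg d Hd) as [d' [Hd' H']]. exists d'. split; auto.
Qed.

Lemma ccont_opp f z : ccont f z -> ccont (fun w => - f w)%C z.
Proof.
intros Hf. apply (ccont_ext_loc _ (fun w => (- (1)) * f w)%C).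
- exists 1. split; [lra|]. intros; ring.
- apply ccont_mult; trivial. apply ccont_const.
Qed.

Lemma ccont_minus f g z : ccont f z -> ccont g z -> ccont (fun w => f w - g w)%C z.
Proof. intros Hf Hg. apply ccont_plus; trivial. now apply ccont_opp. Qed.

Lemma cdiff_ccont f z : cdiff f z -> ccont f z.
Proof.
intros [phi [Hc H]]. apply (ccont_ext_loc _ (fun w => f z + phi w * (w - z))%C).
- exists 1. split; [lra|]. intros w _. rewrite <- H. ring.
- apply ccont_plus; [apply ccont_const|]. apply ccont_mult; trivial.
  apply ccont_minus; [apply ccont_id | apply ccont_const].
Qed.

Lemma cdiff_ext_loc f g z :
  (exists d, 0 < d /\ forall w, Cmod (w - z) < d -> f w = g w) -> cdiff g z -> cdiff f z.
Proof.
intros [d [Hd Hfg]] [phi [Hc H]].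
(* The identity in [cdiff] is global while [f] and [g] agree only near [z], so the quotient has to
   be rebuilt from [f]; it coincides with [phi] near [z]. *)
exists (fun w => if Ceq_dec w z then phi z else (f w - f z) / (w - z))%C. split.
- apply (ccont_ext_loc _ phi); trivial. exists d. split; trivial. intros w Hw.
  destruct (Ceq_dec w z) as [->|Hn]; trivial.
  rewrite !Hfg, H; trivial; [|rewrite Cmod_self; lra].
  field. now apply Cminus_eq_contra.
- intros w. destruct (Ceq_dec w z) as [->|Hn]; [ring|]. field. now apply Cminus_eq_contra.
Qed.

Lemma cdiff_const (c z : C) : cdiff (fun _ => c) z.
Proof. exists (fun _ => RtoC 0). split; [apply ccont_const|]. intros; ring. Qed.

Lemma cdiff_id (z : C) : cdiff (fun w => w) z.
Proof. exists (fun _ => RtoC 1). split; [apply ccont_const|]. intros; ring. Qed.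

Lemma cdiff_plus f g z : cdiff f z -> cdiff g z -> cdiff (fun w => f w + g w)%C z.
Proof.
intros [p [Hp H]] [q [Hq H']]. exists (fun w => p w + q w)%C.
split; [now apply ccont_plus|]. intros w.
replace (f w + g w - (f z + g z))%C with ((f w - f z) + (g w - g z))%C by ring.
rewrite H, H'. ring.
Qed.

Lemma cdiff_mult f g z : cdiff f z -> cdiff g z -> cdiff (fun w => f w * g w)%C z.
Proof.
intros Hf [q [Hq H']]. pose proof (cdiff_ccont _ _ Hf) as Cf. destruct Hf as [p [Hp H]].
exists (fun w => f w * q w + p w * g z)%C. split.
- apply ccont_plus; apply ccont_mult; trivial. apply ccont_const.
- intros w.
  replace (f w * g w - (f z * g z))%C with (f w * (g w - g z) + (f w - f z) * g z)%C by ring.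
  rewrite H, H'. ring.
Qed.

Lemma cdiff_minus f g z : cdiff f z -> cdiff g z -> cdiff (fun w => f w - g w)%C z.
Proof.
intros Hf Hg. apply (cdiff_ext_loc _ (fun w => f w + (- (1)) * g w)%C).
- exists 1. split; [lra|]. intros; ring.
- apply cdiff_plus; trivial. apply cdiff_mult; trivial. apply cdiff_const.
Qed.

Lemma cdiff_inv (f : C -> C) (z : C) : f z <> 0 -> cdiff f z -> cdiff (fun w => / f w)%C z.
Proof.
intros Hz Hf. pose proof (cdiff_ccont _ _ Hf) as Cf.
assert (Hm : 0 < Cmod (f z)) by now apply Cmod_gt_0.
destruct (Cf _ Hm) as [d [Hd Hn]].
assert (Hnz : forall w, Cmod (w - z) < d -> f w <> 0).
{ intros w Hw Hw0. specialize (Hn w Hw). rewrite Hw0 in Hn.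
  replace (0 - f z)%C with (- f z)%C in Hn by ring. rewrite Cmod_opp in Hn. lra. }
destruct Hf as [p [Hp H]].
assert (Hq : ccont (fun w => - p w * / f w * / f z)%C z).
{ repeat apply ccont_mult; try apply ccont_const; [now apply ccont_opp|].
  apply (ccont_comp Cinv); trivial. now apply ccont_inv. }
(* Far from [z] the function [f] may vanish, so the closed formula [- p w * / f w * / f z] is
   available only locally. *)
exists (fun w => if Ceq_dec w z then - p z * / f z * / f z else (/ f w - / f z) / (w - z))%C.
split.
- apply (ccont_ext_loc _ (fun w => - p w * / f w * / f z)%C); trivial.
  exists d. split; trivial. intros w Hw.
  destruct (Ceq_dec w z) as [->|Hwz]; trivial.
  assert (Hpw : p w = ((f w - f z) / (w - z))%C).
  { rewrite H. field. now apply Cminus_eq_contra. }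
  rewrite Hpw. field. repeat split; auto. now apply Cminus_eq_contra.
- intros w. destruct (Ceq_dec w z) as [->|Hwz]; [ring|]. set (A := (/ f w)%C). set (B := (/ f z)%C).
  field. now apply Cminus_eq_contra.
Qed.

Lemma cdiff_comp f g z : cdiff g z -> cdiff f (g z) -> cdiff (fun w => f (g w)) z.
Proof.
intros Hg [p [Hp H]]. pose proof (cdiff_ccont _ _ Hg) as Cg. destruct Hg as [q [Hq H']].
exists (fun w => p (g w) * q w)%C. split.
- apply ccont_mult; trivial. now apply (ccont_comp p g).
- intros w. rewrite H, H'. ring.
Qed.

Lemma cdiff_of_estimate f z l :
  (forall eps, 0 < eps -> exists d, 0 < d /\
    forall w, Cmod (w - z) < d -> Cmod (f w - f z - (w - z) * l) <= eps * Cmod (w - z)) ->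
  cdiff f z.
Proof.
intros H.
exists (fun w => if Ceq_dec w z then l else (f w - f z) / (w - z))%C. split.
- intros eps He. destruct (H (eps / 2) ltac:(lra)) as [d [Hd Hb]].
  exists d. split; trivial. intros w Hw.
  destruct (Ceq_dec z z) as [_|Hf]; [|easy].
  destruct (Ceq_dec w z) as [->|Hwz]; [rewrite Cmod_self; lra|].
  assert (Hn : (w - z)%C <> 0) by now apply Cminus_eq_contra.
  replace ((f w - f z) / (w - z) - l)%C with ((f w - f z - (w - z) * l) / (w - z))%C by (field; auto).
  rewrite Cmod_div by trivial. specialize (Hb w Hw).
  apply Cmod_gt_0 in Hn.
  apply Rle_lt_trans with (eps / 2); [|lra].
  apply (Rmult_le_reg_r (Cmod (w - z))); trivial.
  unfold Rdiv at 1. rewrite Rmult_assoc, Rinv_l by lra. lra.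
- intros w. destruct (Ceq_dec w z) as [->|Hn]; [ring|]. field. now apply Cminus_eq_contra.
Qed.

Lemma is_derive_cdiff (f : C -> C) (z l : C) :
  is_derive (K := C_AbsRing) (V := C_NormedModule) f z l -> cdiff f z.
Proof.
intros [_ Hd]. apply (cdiff_of_estimate f z l). intros eps He.
specialize (Hd z (fun P HP => HP) (mkposreal eps He)).
destruct Hd as [d Hd]. exists d. split; [apply cond_pos|].
intros w Hw. exact (Hd w Hw).
Qed.

Lemma cdiff_estimate f z : cdiff f z -> exists l, forall eps, 0 < eps -> exists d, 0 < d /\
  forall w, Cmod (w - z) < d -> Cmod (f w - f z - (w - z) * l) <= eps * Cmod (w - z).
Proof.
intros [p [Hp H]]. exists (p z). intros eps He. destruct (Hp eps He) as [d [Hd Hb]].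
exists d. split; trivial. intros w Hw. rewrite H.
replace (p w * (w - z) - (w - z) * p z)%C with ((p w - p z) * (w - z))%C by ring.
rewrite Cmod_mult. apply Rmult_le_compat_r; [apply Cmod_ge_0|]. left. now apply Hb.
Qed.

(** * The Cauchy-Riemann equations and the exponential *)

Lemma Cmod_le_sum (x y : R) : Cmod (x, y) <= Rabs x + Rabs y.
Proof.
replace (x, y) with (RtoC x + Ci * RtoC y)%C.
- eapply Rle_trans; [apply Cmod_triangle|]. rewrite Cmod_mult, !Cmod_R.
  replace (Cmod Ci) with 1; [lra|]. symmetry. unfold Cmod, Ci; simpl.
  replace (0 * (0 * 1) + 1 * (1 * 1)) with 1 by ring. apply sqrt_1.
- unfold RtoC, Ci, Cplus, Cmult; simpl. f_equal; ring.
Qed.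

Lemma im_le_Cmod (z : C) : Rabs (Im z) <= Cmod z.
Proof. eapply Rle_trans; [|apply Rmax_Cmod]. apply Rmax_r. Qed.

(** The form is the imaginary part of [F dz], namely [Im F dx + Re F dy], and closedness is one of
    the Cauchy-Riemann equations. This choice puts [Re F] on the vertical sides, which [cexp] maps
    to circles. *)
Lemma cdiff_closed_form F x y :
  cdiff F (x, y) -> closed_form_at (fun u v => Im (F (u, v))) (fun u v => Re (F (u, v))) x y.
Proof.
intros HF. destruct (cdiff_estimate _ _ HF) as [l Hl].
assert (Hl' : forall eps : posreal, locally_2d (fun u v =>
  Cmod (F (u, v) - F (x, y) - ((u, v) - (x, y)) * l) <= eps * Rmax (Rabs (u - x)) (Rabs (v - y))) x y).
{ intros eps. pose proof (cond_pos eps) as He.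
  destruct (Hl (eps / 2) ltac:(lra)) as [d [Hd Hb]].
  exists (mkposreal (d / 2) ltac:(lra)). simpl. intros u v Hu Hv.
  assert (Hs : Cmod ((u, v) - (x, y)) <= Rabs (u - x) + Rabs (v - y))
    by exact (Cmod_le_sum (u - x) (v - y)).
  eapply Rle_trans; [apply Hb; lra|].
  pose proof (Rmax_l (Rabs (u - x)) (Rabs (v - y))).
  pose proof (Rmax_r (Rabs (u - x)) (Rabs (v - y))).
  replace (eps * Rmax (Rabs (u - x)) (Rabs (v - y)))
    with (eps / 2 * (2 * Rmax (Rabs (u - x)) (Rabs (v - y)))) by field.
  apply Rmult_le_compat_l; lra. }
exists (Im l), (Re l), (- Im l). split; intros eps; destruct (Hl' eps) as [d Hd];
  exists d; intros u v Hu Hv; (eapply Rle_trans; [|apply (Hd u v Hu Hv)]).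
- eapply Rle_trans; [|apply im_le_Cmod]. apply Req_le. f_equal.
  destruct (F (u, v)), (F (x, y)), l; unfold Im, Re; simpl; ring.
- eapply Rle_trans; [|apply re_le_Cmod]. apply Req_le. f_equal.
  destruct (F (u, v)), (F (x, y)), l; unfold Im, Re; simpl; ring.
Qed.

Definition cexp (w : C) : C := (exp (Re w) * cos (Im w), exp (Re w) * sin (Im w)).

Lemma cexp_plus w z : cexp (w + z) = (cexp w * cexp z)%C.
Proof.
destruct w as [x y], z as [x' y']. unfold cexp, Cplus, Cmult, Re, Im; simpl.
rewrite exp_plus, cos_plus, sin_plus. f_equal; ring.
Qed.

Lemma Cmod_cexp w : Cmod (cexp w) = exp (Re w).
Proof.
unfold cexp, Cmod; simpl fst; simpl snd.
pose proof (sin2_cos2 (Im w)) as H. unfold Rsqr in H.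
replace ((exp (Re w) * cos (Im w)) ^ 2 + (exp (Re w) * sin (Im w)) ^ 2) with (exp (Re w) ^ 2).
- apply sqrt_pow2. left; apply exp_pos.
- transitivity (exp (Re w) ^ 2 * (sin (Im w) * sin (Im w) + cos (Im w) * cos (Im w))); [rewrite H|]; ring.
Qed.

Lemma derivable_0_estimate g l : derivable_pt_lim g 0 l -> forall eps, 0 < eps ->
  exists d, 0 < d /\ forall h, Rabs h < d -> Rabs (g h - g 0 - l * h) <= eps * Rabs h.
Proof.
intros H eps He. destruct (H eps He) as [d Hd]. exists d. split; [apply cond_pos|].
intros h Hh. destruct (Req_dec h 0) as [->|Hn].
- replace (g 0 - g 0 - l * 0) with 0 by ring. rewrite Rabs_R0. lra.
- specialize (Hd h Hn Hh). rewrite Rplus_0_l in Hd.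
  replace (g h - g 0 - l * h) with (((g h - g 0) / h - l) * h) by (field; trivial).
  rewrite Rabs_mult. apply Rmult_le_compat_r; [apply Rabs_pos|lra].
Qed.

(** Differentiability at 0 follows from the derivatives of [exp], [sin] and [cos] at 0; the addition
    formula transports it to [z]. *)
Lemma cdiff_cexp z : cdiff cexp z.
Proof.
assert (H0 : cdiff cexp (RtoC 0)).
{ apply (cdiff_of_estimate _ _ (RtoC 1)). intros eps He.
  (* The two coordinates of the error cost [4 * (e * m)] and [5 * (e * m)], and [9 / 20 < 1]. The
     bound [e <= 1] gives [exp x <= 3]. *)
  set (e := Rmin 1 (eps / 20)).
  assert (Hepos : 0 < e) by (apply Rmin_pos; lra).
  assert (He1 : e <= 1) by apply Rmin_l. assert (He2 : e <= eps / 20) by apply Rmin_r. clearbody e.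
  destruct (derivable_0_estimate _ _ derivable_pt_lim_exp_0 e Hepos) as [d1 [Hd1 H1]].
  destruct (derivable_0_estimate _ _ derivable_pt_lim_sin_0 e Hepos) as [d2 [Hd2 H2]].
  destruct (derivable_0_estimate _ _ derivable_pt_lim_cos_0 e Hepos) as [d3 [Hd3 H3]].
  exists (Rmin e (Rmin d1 (Rmin d2 d3))). split; [repeat apply Rmin_pos; trivial|].
  intros [x y] Hw.
  pose proof (Rmin_l e (Rmin d1 (Rmin d2 d3))). pose proof (Rmin_r e (Rmin d1 (Rmin d2 d3))).
  pose proof (Rmin_l d1 (Rmin d2 d3)). pose proof (Rmin_r d1 (Rmin d2 d3)).
  pose proof (Rmin_l d2 d3). pose proof (Rmin_r d2 d3).
  replace ((x, y) - 0)%C with ((x, y) : C) in * by (unfold Cminus, Cplus, Copp, RtoC; simpl; f_equal; ring).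
  pose proof (re_le_Cmod (x, y)) as Hx. pose proof (im_le_Cmod (x, y)) as Hy.
  unfold Re, Im in Hx, Hy; simpl in Hx, Hy.
  specialize (H1 x ltac:(lra)). specialize (H2 y ltac:(lra)). specialize (H3 y ltac:(lra)).
  rewrite exp_0 in H1. rewrite sin_0 in H2. rewrite cos_0 in H3.
  set (m := Cmod (x, y)) in *.
  assert (Hm : 0 <= m) by apply Cmod_ge_0.
  replace (cexp (x, y) - cexp 0 - (x, y) * 1)%C with
    ((exp x - 1 - 1 * x) + exp x * (cos y - 1 - 0 * y),
     exp x * (sin y - 0 - 1 * y) + y * (exp x - 1))%R.
  2:{ unfold cexp, Cminus, Cplus, Copp, Cmult, RtoC, Re, Im; simpl.
      rewrite exp_0, cos_0, sin_0. f_equal; ring. }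
  eapply Rle_trans; [apply Cmod_le_sum|].
  assert (A1 : Rabs (exp x - 1 - 1 * x) <= e * m) by (eapply Rle_trans; [apply H1|]; apply Rmult_le_compat_l; lra).
  assert (A2 : Rabs (sin y - 0 - 1 * y) <= e * m) by (eapply Rle_trans; [apply H2|]; apply Rmult_le_compat_l; lra).
  assert (A3 : Rabs (cos y - 1 - 0 * y) <= e * m) by (eapply Rle_trans; [apply H3|]; apply Rmult_le_compat_l; lra).
  assert (em : e * m <= m) by nra.
  assert (A4 : Rabs (exp x - 1) <= 2 * m).
  { apply Rabs_le_between in A1. apply Rabs_le_between in Hx. apply Rabs_le. lra. }
  assert (A5 : Rabs (exp x) <= 3).
  { apply Rabs_le_between in A4. rewrite Rabs_pos_eq by (left; apply exp_pos). lra. }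
  assert (B1 : Rabs (exp x - 1 - 1 * x + exp x * (cos y - 1 - 0 * y)) <= 4 * (e * m)).
  { eapply Rle_trans; [apply Rabs_triang|]. rewrite Rabs_mult.
    assert (Rabs (exp x) * Rabs (cos y - 1 - 0 * y) <= 3 * (e * m))
      by (apply Rmult_le_compat; try apply Rabs_pos; lra). lra. }
  assert (B2 : Rabs (exp x * (sin y - 0 - 1 * y) + y * (exp x - 1)) <= 5 * (e * m)).
  { eapply Rle_trans; [apply Rabs_triang|]. rewrite !Rabs_mult.
    assert (Rabs (exp x) * Rabs (sin y - 0 - 1 * y) <= 3 * (e * m))
      by (apply Rmult_le_compat; try apply Rabs_pos; lra).
    assert (Rabs y * Rabs (exp x - 1) <= e * (2 * m))
      by (apply Rmult_le_compat; try apply Rabs_pos; lra). lra. }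
  assert (e * m <= eps / 20 * m) by (apply Rmult_le_compat_r; lra).
  assert (0 <= eps * m) by (apply Rmult_le_pos; lra). lra. }
apply (cdiff_ext_loc _ (fun w => cexp z * cexp (w - z))%C).
- exists 1. split; [lra|]. intros w _. rewrite <- cexp_plus. f_equal. ring.
- apply cdiff_mult; [apply cdiff_const|]. apply (cdiff_comp cexp).
  + apply cdiff_minus; [apply cdiff_id | apply cdiff_const].
  + now replace (z - z)%C with (RtoC 0) by ring.
Qed.

(** * Integrals over circles *)

Lemma Cmod_arbitrarily_small (X : C) : (forall eps, 0 < eps -> Cmod X <= eps) -> X = RtoC 0.
Proof.
intros H. apply NNPP. intros Hn. apply Cmod_gt_0 in Hn.
specialize (H (Cmod X / 2) ltac:(lra)). lra.
Qed.

Lemma exp_le (x y : R) : x <= y -> exp x <= exp y.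
Proof. intros [H| ->]; [left; now apply exp_increasing | right; reflexivity]. Qed.

Lemma exp_le_inv (x y : R) : exp x <= exp y -> x <= y.
Proof. intros H. destruct (Rle_lt_dec x y) as [|Hl]; trivial. apply exp_increasing in Hl. lra. Qed.

(** A fact about real parts of every function yields the one about imaginary parts after
    multiplication by [- Ci]. *)
Lemma Im_as_Re (z : C) : Im z = Re (- Ci * z)%C.
Proof. destruct z; unfold Im, Re; simpl; ring. Qed.

Lemma ccont_Re_continuity_2d F x y :
  ccont F (x, y) -> continuity_2d_pt (fun u v => Re (F (u, v))) x y.
Proof.
intros H eps. destruct (H eps (cond_pos eps)) as [d [Hd Hb]].
exists (mkposreal (d / 2) ltac:(lra)); simpl. intros u v Hu Hv.
assert (Hs : Cmod ((u, v) - (x, y)) <= Rabs (u - x) + Rabs (v - y))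
  by exact (Cmod_le_sum (u - x) (v - y)).
eapply Rle_lt_trans; [|apply (Hb (u, v)); lra].
eapply Rle_trans; [|apply re_le_Cmod]. apply Req_le. reflexivity.
Qed.

Lemma ccont_Im_continuity_2d F x y :
  ccont F (x, y) -> continuity_2d_pt (fun u v => Im (F (u, v))) x y.
Proof.
intros H. apply (continuity_2d_pt_ext (fun u v => Re (- Ci * F (u, v))%C)).
- intros. now rewrite Im_as_Re.
- apply (ccont_Re_continuity_2d (fun w => - Ci * F w)%C).
  apply ccont_mult; trivial. apply ccont_const.
Qed.

Lemma Cmod_cexp_pair u v : Cmod (cexp (u, v)) = exp u.
Proof. exact (Cmod_cexp (u, v)). Qed.

(* The circle has radius [exp u], and the integral is against the angle, not against [d zeta]. *)
Definition circle_integral (H : C -> C) (u : R) : C :=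
  (RInt (fun v => Re (H (cexp (u, v)))) 0 (2 * PI),
   RInt (fun v => Im (H (cexp (u, v)))) 0 (2 * PI)).

Definition cont_on_circle (H : C -> C) (u : R) : Prop :=
  forall zeta, Cmod zeta = exp u -> ccont H zeta.

Lemma ccont_cexp_comp H u v : cont_on_circle H u -> ccont (fun w => H (cexp w)) (u, v).
Proof.
intros Hc. apply (ccont_comp H cexp).
- apply cdiff_ccont, cdiff_cexp.
- apply Hc, Cmod_cexp_pair.
Qed.

Lemma circle_ex_RInt_Re H u : cont_on_circle H u ->
  ex_RInt (fun v => Re (H (cexp (u, v)))) 0 (2 * PI).
Proof.
intros Hc. apply (ex_RInt_continuous (V := R_CompleteNormedModule)). intros v _.
apply (continuity_2d_snd (fun u v => Re (H (cexp (u, v))))).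
apply (ccont_Re_continuity_2d (fun w => H (cexp w))). now apply ccont_cexp_comp.
Qed.

Lemma circle_ex_RInt_Im H u : cont_on_circle H u ->
  ex_RInt (fun v => Im (H (cexp (u, v)))) 0 (2 * PI).
Proof.
intros Hc. apply (ex_RInt_continuous (V := R_CompleteNormedModule)). intros v _.
apply (continuity_2d_snd (fun u v => Im (H (cexp (u, v))))).
apply (ccont_Im_continuity_2d (fun w => H (cexp w))). now apply ccont_cexp_comp.
Qed.

Lemma circle_integral_ext H K u :
  (forall zeta, Cmod zeta = exp u -> H zeta = K zeta) ->
  circle_integral H u = circle_integral K u.
Proof.
intros HK. unfold circle_integral. f_equal; apply RInt_ext; intros v _;
  rewrite HK; trivial; apply Cmod_cexp_pair.
Qed.

Lemma RInt_Rplus (f g : R -> R) a b : ex_RInt f a b -> ex_RInt g a b ->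
  RInt (fun x => f x + g x) a b = RInt f a b + RInt g a b.
Proof. exact (RInt_plus (V := R_CompleteNormedModule) f g a b). Qed.

Lemma RInt_Rminus (f g : R -> R) a b : ex_RInt f a b -> ex_RInt g a b ->
  RInt (fun x => f x - g x) a b = RInt f a b - RInt g a b.
Proof. exact (RInt_minus (V := R_CompleteNormedModule) f g a b). Qed.

Lemma RInt_Rscal (f : R -> R) a b l : ex_RInt f a b ->
  RInt (fun x => l * f x) a b = l * RInt f a b.
Proof. exact (RInt_scal (V := R_CompleteNormedModule) f a b l). Qed.

Lemma circle_integral_plus H K u : cont_on_circle H u -> cont_on_circle K u ->
  circle_integral (fun w => H w + K w)%C u = (circle_integral H u + circle_integral K u)%C.
Proof.
intros HH HK. unfold circle_integral, Cplus at 3; simpl. f_equal.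
- rewrite <- RInt_Rplus by now apply circle_ex_RInt_Re.
  apply RInt_ext. intros v _. apply re_plus.
- rewrite <- RInt_Rplus by now apply circle_ex_RInt_Im.
  apply RInt_ext. intros v _. apply im_plus.
Qed.

Lemma circle_integral_scal (c : C) H u : cont_on_circle H u ->
  circle_integral (fun w => c * H w)%C u = (c * circle_integral H u)%C.
Proof.
intros HH. destruct c as [a b]. unfold circle_integral, Cmult at 3; simpl.
pose proof (circle_ex_RInt_Re H u HH) as E1. pose proof (circle_ex_RInt_Im H u HH) as E2.
rewrite <- !RInt_Rscal by trivial. f_equal.
- rewrite <- RInt_Rminus by (apply (ex_RInt_scal (V := R_NormedModule)); trivial).
  apply RInt_ext. intros v _. reflexivity.
- rewrite <- RInt_Rplus by (apply (ex_RInt_scal (V := R_NormedModule)); trivial).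
  apply RInt_ext. intros v _. reflexivity.
Qed.

Lemma circle_integral_const (c : C) u : circle_integral (fun _ => c) u = (2 * PI * c)%C.
Proof.
unfold circle_integral. rewrite !RInt_const. destruct c as [a b].
unfold scal, Cmult, RtoC, Re, Im; simpl. unfold mult; simpl. f_equal; ring.
Qed.

(** The constant is [4 * PI] instead of the sharp [2 * PI] because both coordinates are estimated
    separately; this suffices for limits. *)
Lemma circle_integral_bound H u M : cont_on_circle H u ->
  (forall v, 0 <= v <= 2 * PI -> Cmod (H (cexp (u, v))) <= M) ->
  Cmod (circle_integral H u) <= 4 * PI * M.
Proof.
intros HH HM. pose proof PI_RGT_0.
eapply Rle_trans; [apply Cmod_le_sum|].
assert (Rabs (RInt (fun v => Re (H (cexp (u, v)))) 0 (2 * PI)) <= (2 * PI - 0) * M).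
{ apply abs_RInt_le_const; [lra|now apply circle_ex_RInt_Re|]. intros v Hv.
  eapply Rle_trans; [apply re_le_Cmod|]. now apply HM. }
assert (Rabs (RInt (fun v => Im (H (cexp (u, v)))) 0 (2 * PI)) <= (2 * PI - 0) * M).
{ apply abs_RInt_le_const; [lra|now apply circle_ex_RInt_Im|]. intros v Hv.
  eapply Rle_trans; [apply im_le_Cmod|]. now apply HM. }
lra.
Qed.

Lemma cexp_period u : cexp (u, 2 * PI) = cexp (u, 0).
Proof. unfold cexp, Re, Im; simpl. now rewrite cos_2PI, sin_2PI, cos_0, sin_0. Qed.

(* Goursat on a rectangle of logarithmic coordinates: the horizontal sides cancel
   because [cexp] is periodic. *)
Lemma circle_integral_annulus H u1 u2 : u1 <= u2 ->
  (forall zeta, exp u1 <= Cmod zeta <= exp u2 -> cdiff H zeta) ->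
  circle_integral H u1 = circle_integral H u2.
Proof.
intros Hu HH. pose proof PI_RGT_0.
assert (K : forall G, (forall zeta, exp u1 <= Cmod zeta <= exp u2 -> cdiff G zeta) ->
  RInt (fun v => Re (G (cexp (u1, v)))) 0 (2 * PI) = RInt (fun v => Re (G (cexp (u2, v)))) 0 (2 * PI)).
{ intros G HG.
  assert (E : boundary_integral (fun u v => Im (G (cexp (u, v)))) (fun u v => Re (G (cexp (u, v))))
    u1 u2 0 (2 * PI) = 0).
  { apply goursat; [|trivial|lra]. intros x y Hx Hy.
    apply (cdiff_closed_form (fun w => G (cexp w))).
    apply (cdiff_comp G cexp); [apply cdiff_cexp|]. apply HG. rewrite Cmod_cexp_pair.
    split; apply exp_le; lra. }
  unfold boundary_integral in E.
  rewrite (RInt_ext (fun x => Im (G (cexp (x, 2 * PI)))) (fun x => Im (G (cexp (x, 0))))) in E.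
  - lra.
  - intros x _. now rewrite cexp_period. }
unfold circle_integral. f_equal; [now apply K|].
rewrite (RInt_ext _ (fun v => Re (- Ci * H (cexp (u1, v)))%C)) by (intros; apply Im_as_Re).
rewrite (RInt_ext (fun v => Im (H (cexp (u2, v)))) (fun v => Re (- Ci * H (cexp (u2, v)))%C))
  by (intros; apply Im_as_Re).
apply (K (fun w => - Ci * H w)%C). intros z Hz. apply cdiff_mult; [apply cdiff_const|auto].
Qed.

(** Carries a value onto or across a circle containing a point where [H] is merely continuous, which
    [circle_integral_annulus] cannot do. *)
Lemma circle_integral_unif_cont H u1 u2 :
  (forall zeta, exp u1 <= Cmod zeta <= exp u2 -> ccont H zeta) ->
  forall eps, 0 < eps -> exists d, 0 < d /\ forall u u', u1 <= u <= u2 -> u1 <= u' <= u2 ->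
    Rabs (u' - u) < d -> Cmod (circle_integral H u' - circle_integral H u) <= eps.
Proof.
intros HH eps He. pose proof PI_RGT_0.
assert (Hcirc : forall u, u1 <= u <= u2 -> cont_on_circle H u).
{ intros u Hu z Hz. apply HH. rewrite Hz. split; apply exp_le; lra. }
assert (He' : 0 < eps / (4 * PI)) by (apply Rdiv_lt_0_compat; lra).
destruct (uniform_continuity_2d (fun u v => Re (H (cexp (u, v)))) u1 u2 0 (2 * PI))
  with (eps := mkposreal _ He') as [d1 H1].
{ intros u v Hu _. apply (ccont_Re_continuity_2d (fun w => H (cexp w))). apply ccont_cexp_comp; auto. }
destruct (uniform_continuity_2d (fun u v => Im (H (cexp (u, v)))) u1 u2 0 (2 * PI))
  with (eps := mkposreal _ He') as [d2 H2].
{ intros u v Hu _. apply (ccont_Im_continuity_2d (fun w => H (cexp w))). apply ccont_cexp_comp; auto. }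
simpl in H1, H2.
exists (Rmin d1 d2). split; [apply Rmin_pos; apply cond_pos|].
intros u u' Hu Hu' Hd.
pose proof (Rmin_l d1 d2). pose proof (Rmin_r d1 d2).
pose proof (cond_pos d1). pose proof (cond_pos d2).
unfold circle_integral, Cminus, Copp, Cplus; simpl.
eapply Rle_trans; [apply Cmod_le_sum|].
assert (A1 : Rabs (RInt (fun v => Re (H (cexp (u', v)))) 0 (2 * PI) +
  - RInt (fun v => Re (H (cexp (u, v)))) 0 (2 * PI)) <= (2 * PI - 0) * (eps / (4 * PI))).
{ fold (Rminus (RInt (fun v => Re (H (cexp (u', v)))) 0 (2 * PI)) (RInt (fun v => Re (H (cexp (u, v)))) 0 (2 * PI))).
  rewrite <- (RInt_Rminus (fun v => Re (H (cexp (u', v)))) (fun v => Re (H (cexp (u, v))))) by (apply circle_ex_RInt_Re; auto).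
  apply abs_RInt_le_const; [lra| |].
  - apply (ex_RInt_minus (V := R_NormedModule)); apply circle_ex_RInt_Re; auto.
  - intros v Hv. left. apply H1; trivial; try lra.
    replace (v - v) with 0 by ring. rewrite Rabs_R0. lra. }
assert (A2 : Rabs (RInt (fun v => Im (H (cexp (u', v)))) 0 (2 * PI) +
  - RInt (fun v => Im (H (cexp (u, v)))) 0 (2 * PI)) <= (2 * PI - 0) * (eps / (4 * PI))).
{ fold (Rminus (RInt (fun v => Im (H (cexp (u', v)))) 0 (2 * PI)) (RInt (fun v => Im (H (cexp (u, v)))) 0 (2 * PI))).
  rewrite <- (RInt_Rminus (fun v => Im (H (cexp (u', v)))) (fun v => Im (H (cexp (u, v))))) by (apply circle_ex_RInt_Im; auto).
  apply abs_RInt_le_const; [lra| |].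
  - apply (ex_RInt_minus (V := R_NormedModule)); apply circle_ex_RInt_Im; auto.
  - intros v Hv. left. apply H2; trivial; try lra.
    replace (v - v) with 0 by ring. rewrite Rabs_R0. lra. }
replace eps with ((2 * PI - 0) * (eps / (4 * PI)) + (2 * PI - 0) * (eps / (4 * PI))) by (field; lra).
lra.
Qed.

(** The integral does not change with the radius, except perhaps at radius [Cmod z], and it tends to
    0 as the circle shrinks because [H] vanishes at the centre. Continuity in the radius bridges the
    circle through [z]. *)
Lemma circle_integral_eq_0 (H : C -> C) (z : C) (rho u : R) :
  (forall zeta, Cmod zeta < rho -> ccont H zeta) -> H (RtoC 0) = RtoC 0 ->
  (forall zeta, 0 < Cmod zeta < rho -> zeta <> z -> cdiff H zeta) ->
  exp u < rho -> circle_integral H u = RtoC 0.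
Proof.
intros Hc H0 Hd Hu. pose proof PI_RGT_0.
assert (Hcirc : forall u', u' <= u -> cont_on_circle H u').
{ intros u' Hu' w Hw. apply Hc. apply exp_le in Hu'. lra. }
assert (Hann : forall u1 u2, u1 <= u2 -> u2 <= u ->
  (forall w, u1 <= w <= u2 -> exp w <> Cmod z) -> circle_integral H u1 = circle_integral H u2).
{ intros u1 u2 H12 H2u Hz. apply circle_integral_annulus; trivial. intros w [Hw1 Hw2].
  pose proof (exp_pos u1). apply exp_le in H2u.
  apply Hd; [lra|]. intros ->. apply (Hz (ln (Cmod z))).
  - split; apply exp_le_inv; rewrite exp_ln; lra.
  - apply exp_ln; lra. }
assert (A : forall u', u' <= u -> (forall w, w <= u' -> exp w <> Cmod z) ->
  circle_integral H u' = RtoC 0).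
{ intros u' Hu' Hz. apply Cmod_arbitrarily_small. intros eps He.
  assert (He' : 0 < eps / (4 * PI)) by (apply Rdiv_lt_0_compat; lra).
  assert (Hr : Cmod (RtoC 0) < rho) by (rewrite Cmod_0; pose proof (exp_pos u); lra).
  destruct (Hc _ Hr _ He') as [d [Hd0 Hb]].
  (* A circle so small that [H] stays below [eps / (4 * PI)] on it. *)
  set (s := Rmin u' (ln (d / 2))).
  assert (Hs1 : s <= u') by apply Rmin_l.
  assert (Hs2 : exp s <= d / 2).
  { rewrite <- (exp_ln (d / 2)) by lra. apply exp_le. apply Rmin_r. }
  rewrite <- (Hann s u'); trivial; [|intros w [_ Hw]; auto].
  replace eps with (4 * PI * (eps / (4 * PI))) by (field; lra).
  apply circle_integral_bound; [apply Hcirc; lra|]. intros v _. left.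
  specialize (Hb (cexp (s, v))). rewrite H0 in Hb.
  replace (H (cexp (s, v)) - 0)%C with (H (cexp (s, v))) in Hb by ring.
  replace (cexp (s, v) - 0)%C with (cexp (s, v)) in Hb by ring.
  rewrite Cmod_cexp_pair in Hb. apply Hb. lra. }
destruct (Rle_lt_dec (Cmod z) 0) as [Hz0|Hz0].
{ apply A; [lra|]. intros w _. pose proof (exp_pos w). lra. }
set (u0 := ln (Cmod z)). assert (E0 : exp u0 = Cmod z) by now apply exp_ln.
assert (Hne : forall w, w <> u0 -> exp w <> Cmod z).
{ intros w Hw E. apply Hw. unfold u0. now rewrite <- E, ln_exp. }
destruct (Rlt_le_dec u u0) as [Hlt|Hge].
{ apply A; [lra|]. intros w Hw. apply Hne. lra. }
assert (Hunif := circle_integral_unif_cont H (u0 - 1) u).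
assert (Hcc : forall zeta, exp (u0 - 1) <= Cmod zeta <= exp u -> ccont H zeta).
{ intros w [_ Hw]. apply Hc. lra. }
specialize (Hunif Hcc).
(* The circle through [z] is a limit of smaller circles, where [A] applies. *)
assert (B : circle_integral H u0 = RtoC 0).
{ apply Cmod_arbitrarily_small. intros eps He.
  destruct (Hunif eps He) as [d [Hd0 Hb]].
  set (s := u0 - Rmin 1 (d / 2)).
  assert (M1 := Rmin_l 1 (d / 2)). assert (M2 := Rmin_r 1 (d / 2)).
  assert (M3 : 0 < Rmin 1 (d / 2)) by (apply Rmin_pos; lra).
  assert (Hs : circle_integral H s = RtoC 0).
  { apply A; [unfold s; lra|]. intros w Hw. apply Hne. unfold s in Hw. lra. }
  specialize (Hb s u0). rewrite Hs in Hb.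
  replace (circle_integral H u0 - 0)%C with (circle_integral H u0) in Hb by ring.
  apply Hb; unfold s; try lra. replace (u0 - (u0 - Rmin 1 (d / 2))) with (Rmin 1 (d / 2)) by ring.
  rewrite Rabs_pos_eq; lra. }
(* Beyond [z]: shrink to a circle just outside radius [Cmod z] and compare it with [B]. *)
destruct (Rle_lt_or_eq_dec _ _ Hge) as [Hgt|Heq]; [|now rewrite <- Heq].
apply Cmod_arbitrarily_small. intros eps He.
destruct (Hunif eps He) as [d [Hd0 Hb]].
set (s := u0 + Rmin (u - u0) (d / 2)).
assert (M1 := Rmin_l (u - u0) (d / 2)). assert (M2 := Rmin_r (u - u0) (d / 2)).
assert (M3 : 0 < Rmin (u - u0) (d / 2)) by (apply Rmin_pos; lra).
rewrite <- (Hann s u); [| unfold s; lra | lra |].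
- specialize (Hb u0 s). rewrite B in Hb.
  replace (circle_integral H s - 0)%C with (circle_integral H s) in Hb by ring.
  apply Hb; unfold s; try lra. replace (u0 + Rmin (u - u0) (d / 2) - u0) with (Rmin (u - u0) (d / 2)) by ring.
  rewrite Rabs_pos_eq; lra.
- intros w Hw. apply Hne. unfold s in Hw. lra.
Qed.

(** * Cauchy's formula and Taylor expansion *)

Lemma neq_of_Cmod (w z : C) : Cmod z < Cmod w -> (w - z)%C <> RtoC 0.
Proof. intros H. apply Cminus_eq_contra. intros ->. lra. Qed.

Lemma cdiff_cauchy_kernel (z w : C) : Cmod z < Cmod w -> cdiff (fun zeta => zeta * / (zeta - z))%C w.
Proof.
intros H. apply cdiff_mult; [apply cdiff_id|]. apply (cdiff_inv (fun x => x - z)%C).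
- now apply neq_of_Cmod.
- apply cdiff_minus; [apply cdiff_id|apply cdiff_const].
Qed.

(** The kernel is [1 + z / (zeta - z)] and is holomorphic outside the circle, so the radius may grow
    until the second term is negligible. *)
Lemma circle_integral_cauchy_kernel (z : C) (u : R) : Cmod z < exp u ->
  circle_integral (fun zeta => zeta * / (zeta - z))%C u = (2 * PI)%C.
Proof.
intros Hz. pose proof PI_RGT_0 as HPI. pose proof (Cmod_ge_0 z) as Hz0.
enough (E : (circle_integral (fun zeta => zeta * / (zeta - z)) u - 2 * PI)%C = RtoC 0)
  by (apply Ceq_minus; exact E).
apply Cmod_arbitrarily_small. intros eps He.
(* At this radius [Cmod (zeta - z)] is at least [4 * PI * Cmod z / eps], as [circle_integral_bound]
   requires. *)
set (R0 := Rmax (exp u) (Cmod z + 4 * PI * Cmod z / eps)).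
assert (HR1 : exp u <= R0) by apply Rmax_l.
assert (HR2 : Cmod z + 4 * PI * Cmod z / eps <= R0) by apply Rmax_r.
pose proof (exp_pos u) as Hup.
set (s := ln R0). assert (Es : exp s = R0) by (apply exp_ln; lra).
rewrite (circle_integral_annulus _ u s).
2:{ apply exp_le_inv. lra. }
2:{ intros w Hw. apply cdiff_cauchy_kernel. lra. }
assert (Hk : forall zeta, Cmod zeta = exp s -> Cmod z < Cmod zeta) by (intros; lra).
assert (C1 : cont_on_circle (fun zeta => z * / (zeta - z))%C s).
{ intros w Hw. apply ccont_mult; [apply ccont_const|].
  apply (ccont_comp Cinv (fun x => x - z)%C).
  - apply ccont_minus; [apply ccont_id|apply ccont_const].
  - apply ccont_inv. apply neq_of_Cmod. auto. }
rewrite (circle_integral_ext _ (fun zeta => RtoC 1 + z * / (zeta - z))%C).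
2:{ intros w Hw. field. apply neq_of_Cmod. auto. }
rewrite circle_integral_plus; trivial; [|intros ? _; apply ccont_const].
rewrite circle_integral_const.
match goal with |- Cmod ?x <= _ => replace x with (circle_integral (fun zeta => z * / (zeta - z))%C s) by ring end.
destruct (Req_dec (Cmod z) 0) as [Ez|Ez].
- eapply Rle_trans; [apply (circle_integral_bound _ _ 0)|lra]; trivial.
  intros v _. rewrite Cmod_mult, Ez. lra.
- replace eps with (4 * PI * (eps / (4 * PI))) by (field; lra).
  apply circle_integral_bound; trivial. intros v _.
  assert (Hm : Cmod (cexp (s, v)) = exp s) by apply Cmod_cexp_pair.
  rewrite Cmod_mult, Cmod_inv by (apply neq_of_Cmod; auto).
  assert (Hq : 4 * PI * Cmod z / eps <= Cmod (cexp (s, v) - z)).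
  { pose proof (Cmod_reverse_triangle (cexp (s, v)) z). lra. }
  assert (Hqp : 0 < 4 * PI * Cmod z / eps).
  { apply Rdiv_lt_0_compat; trivial. apply Rmult_lt_0_compat; lra. }
  apply (Rmult_le_reg_r (Cmod (cexp (s, v) - z))); [lra|].
  rewrite Rmult_assoc, Rinv_l by lra.
  replace (Cmod z * 1) with (eps / (4 * PI) * (4 * PI * Cmod z / eps)) by (field; lra).
  apply Rmult_le_compat_l; trivial. left. apply Rdiv_lt_0_compat; lra.
Qed.

(** With [phi] the difference quotient at [z], the integrand is [phi zeta * zeta] plus [f z] times
    the kernel. The first term is continuous everywhere, differentiable off [z] and zero at the
    centre, so [circle_integral_eq_0] removes it. *)
Lemma cauchy_formula (f : C -> C) (z : C) (rho u : R) :
  (forall zeta, Cmod zeta < rho -> cdiff f zeta) -> Cmod z < exp u -> exp u < rho ->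
  circle_integral (fun zeta => f zeta * (zeta * / (zeta - z)))%C u = (2 * PI * f z)%C.
Proof.
intros Hf Hz Hu.
assert (Hzr : Cmod z < rho) by lra.
destruct (Hf z Hzr) as [phi [Hp1 Hp2]].
assert (Hpd : forall zeta, Cmod zeta < rho -> zeta <> z -> cdiff phi zeta).
{ intros w Hw Hwz. apply (cdiff_ext_loc _ (fun x => (f x - f z) * / (x - z))%C).
  - exists (Cmod (w - z)). split; [apply Cmod_gt_0; now apply Cminus_eq_contra|].
    intros x Hx. rewrite Hp2. field. apply Cminus_eq_contra. intros ->.
    rewrite (Cmod_minus_sym z w) in Hx. lra.
  - apply cdiff_mult.
    + apply cdiff_minus; [now apply Hf|apply cdiff_const].
    + apply (cdiff_inv (fun x => x - z)%C); [now apply Cminus_eq_contra|].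
      apply cdiff_minus; [apply cdiff_id|apply cdiff_const]. }
assert (E : circle_integral (fun zeta => phi zeta * zeta)%C u = RtoC 0).
{ apply (circle_integral_eq_0 _ z rho); trivial.
  - intros w Hw. apply ccont_mult; [|apply ccont_id].
    destruct (Ceq_dec w z) as [->|Hn]; trivial. apply cdiff_ccont. auto.
  - ring.
  - intros w [_ Hw] Hwz. apply cdiff_mult; [auto|apply cdiff_id]. }
assert (Hk : cont_on_circle (fun zeta => zeta * / (zeta - z))%C u).
{ intros w Hw. apply cdiff_ccont, cdiff_cauchy_kernel. lra. }
rewrite (circle_integral_ext _ (fun zeta => phi zeta * zeta + f z * (zeta * / (zeta - z)))%C).
- rewrite circle_integral_plus, E, circle_integral_scal, circle_integral_cauchy_kernel; trivial; try ring.
  + intros w Hw. apply ccont_mult; [|apply ccont_id]. apply cdiff_ccont, Hpd; [lra|].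
    intros ->. lra.
  + intros w Hw. apply ccont_mult; [apply ccont_const|auto].
- intros w Hw. assert (Hn : (w - z)%C <> RtoC 0) by (apply neq_of_Cmod; lra).
  assert (Hphi : phi w = ((f w - f z) * / (w - z))%C) by (rewrite Hp2; field; trivial).
  rewrite Hphi. field. trivial.
Qed.

Lemma cont_circle_bounded (f : C -> C) u : cont_on_circle f u ->
  exists M, 0 <= M /\ forall v, 0 <= v <= 2 * PI -> Cmod (f (cexp (u, v))) <= M.
Proof.
intros Hf. pose proof PI_RGT_0.
destruct (continuity_ab_maj (fun v => Cmod (f (cexp (u, v)))) 0 (2 * PI)) as [m [Hm _]]; [lra| |].
- intros v _ eps He. destruct (ccont_cexp_comp f u v Hf eps He) as [d [Hd Hb]].
  exists d. split; trivial. intros x [_ Hx]. simpl in *. unfold R_dist in *.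
  assert (Hs : Cmod ((u, x) - (u, v)) < d).
  { eapply Rle_lt_trans; [exact (Cmod_le_sum (u - u) (x - v))|].
    replace (u - u) with 0 by ring. rewrite Rabs_R0. lra. }
  specialize (Hb (u, x) Hs). eapply Rle_lt_trans; [|apply Hb].
  pose proof (Cmod_reverse_triangle (f (cexp (u, x))) (f (cexp (u, v)))).
  pose proof (Cmod_reverse_triangle (f (cexp (u, v))) (f (cexp (u, x)))) as H2.
  rewrite (Cmod_minus_sym (f (cexp (u, v)))) in H2.
  apply Rabs_le. lra.
- exists (Cmod (f (cexp (u, m)))). split; trivial. apply Cmod_ge_0.
Qed.

(* Taylor's formula in recursive form: [T N] is the [N]-th remainder divided by [z^N]. *)
Lemma taylor (f : C -> C) (rho r : R) :
  (forall zeta, Cmod zeta < rho -> cdiff f zeta) -> 0 < r < rho ->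
  exists (c : nat -> C) (T : nat -> C -> C) (K : R), 0 <= K /\
    forall z, Cmod z <= r / 2 -> T O z = f z /\
      forall N, T N z = (c N + z * T (S N) z)%C /\ Cmod (T N z) <= K / r ^ N.
Proof.
intros Hf Hr. pose proof PI_RGT_0 as HPI.
set (u := ln r). assert (Eu : exp u = r) by (apply exp_ln; lra).
assert (Hcf : cont_on_circle f u) by (intros w Hw; apply cdiff_ccont, Hf; lra).
destruct (cont_circle_bounded f u Hcf) as [M [HM0 HM]].
assert (HPIC : RtoC PI <> RtoC 0) by (intros E; apply RtoC_inj in E; lra).
assert (H2C : RtoC 2 <> RtoC 0) by (intros E; apply RtoC_inj in E; lra).
assert (Hci : forall w, Cmod w = exp u -> ccont Cinv w).
{ intros w Hw. apply ccont_inv, Cmod_gt_0. lra. }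
assert (Hpow : forall N, cont_on_circle (fun w => f w * (/ w) ^ N)%C u).
{ intros N w Hw. apply ccont_mult; [auto|]. induction N as [|N IH]; simpl.
  - apply ccont_const.
  - apply ccont_mult; auto. }
assert (Hker : forall N z, Cmod z <= r / 2 ->
  cont_on_circle (fun w => f w * (/ w) ^ N * (w * / (w - z)))%C u).
{ intros N z Hz w Hw. apply ccont_mult; [now apply Hpow|].
  apply cdiff_ccont, cdiff_cauchy_kernel. lra. }
(* The recursion comes from [w / (w - z) = 1 + z * / w * (w / (w - z))] under the integral; the
   geometric series is never summed. *)
exists (fun N => / (2 * PI) * circle_integral (fun w => f w * (/ w) ^ N)%C u)%C.
exists (fun N z => / (2 * PI) * circle_integral (fun w => f w * (/ w) ^ N * (w * / (w - z)))%C u)%C.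
(* The kernel is at most 2 for [Cmod z <= r / 2], and [4 * PI * 2 / (2 * PI) = 4]. *)
exists (4 * M). split; [lra|]. intros z Hz. split; [|intros N; split].
- rewrite (circle_integral_ext _ (fun w => f w * (w * / (w - z)))%C) by (intros; simpl; ring).
  rewrite (cauchy_formula f z rho u) by (trivial; lra). field. auto.
- rewrite (circle_integral_ext _
    (fun w => f w * (/ w) ^ N + z * (f w * (/ w) ^ (S N) * (w * / (w - z))))%C).
  + rewrite circle_integral_plus, circle_integral_scal; [ring| | |].
    * now apply Hker.
    * apply Hpow.
    * intros w Hw. apply ccont_mult; [apply ccont_const|]. now apply Hker.
  + intros w Hw. rewrite Cpow_S. set (p := ((/ w) ^ N)%C). field. split.
    * apply neq_of_Cmod. lra.
    * apply Cmod_gt_0. lra.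
- rewrite Cmod_mult, Cmod_inv, Cmod_mult, !Cmod_R, !Rabs_pos_eq
    by (try apply Cmult_neq_0; trivial; lra).
  assert (Hrn : 0 < r ^ N) by (apply pow_lt; lra).
  apply (Rmult_le_reg_l (2 * PI)); [lra|].
  rewrite <- Rmult_assoc, Rinv_r, Rmult_1_l by lra.
  replace (2 * PI * (4 * M / r ^ N)) with (4 * PI * (M * (/ r ^ N) * 2)) by (field; lra).
  apply circle_integral_bound; [now apply Hker|]. intros v Hv.
  set (w := cexp (u, v)). assert (Hw : Cmod w = r) by (unfold w; rewrite Cmod_cexp_pair; trivial).
  rewrite !Cmod_mult, Cmod_pow, !Cmod_inv, Hw, pow_inv
    by (try (apply neq_of_Cmod; lra); apply Cmod_gt_0; lra).
  apply Rmult_le_compat.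
  + apply Rmult_le_pos; [apply Cmod_ge_0|]. left. now apply Rinv_0_lt_compat.
  + apply Rmult_le_pos; [lra|]. left. apply Rinv_0_lt_compat.
    pose proof (Cmod_reverse_triangle w z). lra.
  + apply Rmult_le_compat_r; [|now apply HM]. left. now apply Rinv_0_lt_compat.
  + pose proof (Cmod_reverse_triangle w z).
    apply (Rmult_le_reg_r (Cmod (w - z))); [lra|].
    rewrite Rmult_assoc, Rinv_l by lra. lra.
Qed.

(** * Leading terms and the identity theorem on the strip *)

Lemma Cmod_unit_scal (t : R) (w : C) : 0 <= t -> Cmod w = 1 -> Cmod (t * w)%C = t.
Proof. intros Ht Hw. rewrite Cmod_mult, Cmod_R, Hw, Rabs_pos_eq by trivial. ring. Qed.

(** Stands in for letting [t] tend to 0 whenever leading coefficients are compared. *)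
Lemma le_0_of_le_linear (A K d : R) : 0 < d -> (forall t, 0 < t < d -> A <= K * t) -> A <= 0.
Proof.
intros Hd H. apply Rnot_lt_le. intros HA.
set (t := Rmin (d / 2) (A / (2 * (Rabs K + 1)))).
pose proof (Rabs_pos K) as HK. pose proof (Rle_abs K) as HK'.
assert (Hq : 0 < A / (2 * (Rabs K + 1))) by (apply Rdiv_lt_0_compat; lra).
assert (Ht : 0 < t) by (apply Rmin_pos; lra).
assert (Ht1 : t <= d / 2) by apply Rmin_l.
assert (Ht2 : t <= A / (2 * (Rabs K + 1))) by apply Rmin_r.
specialize (H t ltac:(lra)).
assert (K * t <= (Rabs K + 1) * (A / (2 * (Rabs K + 1)))).
{ apply Rle_trans with ((Rabs K + 1) * t).
  - apply Rmult_le_compat_r; lra.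
  - apply Rmult_le_compat_l; lra. }
replace ((Rabs K + 1) * (A / (2 * (Rabs K + 1)))) with (A / 2) in H0 by (field; lra).
lra.
Qed.

Lemma least_nonzero (c : nat -> C) (n : nat) :
  (forall k, (k < n)%nat -> c k = RtoC 0) \/
  exists m, c m <> RtoC 0 /\ forall k, (k < m)%nat -> c k = RtoC 0.
Proof.
induction n as [|n [IH|IH]]; [left; lia| |now right].
destruct (Ceq_dec (c n) (RtoC 0)) as [E|E].
- left. intros k Hk. destruct (Nat.eq_dec k n) as [->|]; trivial. apply IH. lia.
- right. now exists n.
Qed.

(** Either some Taylor coefficient is nonzero and the first such factors out, or
    [f (p + z) = z ^ N * T N z] for every [N]. The radius [rho / 4] is half of the circle radius
    [rho / 2] used in [taylor]. *)
Lemma local_form (f : C -> C) (p : C) (rho : R) : 0 < rho ->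
  (forall w, Cmod (w - p) < rho -> cdiff f w) ->
  (forall z, Cmod z <= rho / 4 -> f (p + z)%C = RtoC 0) \/
  exists m c E K, c <> RtoC 0 /\ 0 <= K /\ forall z, Cmod z <= rho / 4 ->
    f (p + z)%C = (z ^ m * (c + z * E z))%C /\ Cmod (E z) <= K.
Proof.
intros Hrho Hf.
destruct (taylor (fun z => f (p + z))%C rho (rho / 2)) as (c & T & K & HK & HT).
{ intros z Hz. apply (cdiff_comp f (fun x => p + x)%C).
  - apply cdiff_plus; [apply cdiff_const|apply cdiff_id].
  - apply Hf. now replace (p + z - p)%C with z by ring. }
{ lra. }
replace (rho / 2 / 2) with (rho / 4) in HT by field.
assert (Hpow : forall N, (forall k, (k < N)%nat -> c k = RtoC 0) ->
  forall z, Cmod z <= rho / 4 -> f (p + z)%C = (z ^ N * T N z)%C).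
{ induction N as [|N IH]; intros Hc z Hz.
  - rewrite (proj1 (HT z Hz)). simpl. ring.
  - rewrite IH; trivial; [|intros; apply Hc; lia].
    rewrite (proj1 (proj2 (HT z Hz) N)), Hc by lia. rewrite Cpow_S. ring. }
destruct (classic (exists m, c m <> RtoC 0 /\ forall k, (k < m)%nat -> c k = RtoC 0))
  as [(m & Hm & Hlt)|Hno].
- right. exists m, (c m), (T (S m)), (K / (rho / 2) ^ (S m)).
  split; trivial. split.
  + apply Rdiv_le_0_compat; trivial. apply pow_lt. lra.
  + intros z Hz. destruct (HT z Hz) as [_ HN]. split; [|apply HN].
    rewrite (Hpow m Hlt z Hz), (proj1 (HN m)). reflexivity.
- left. intros z Hz. apply Cmod_arbitrarily_small. intros eps He.
  (* All coefficients vanish here, and the remainder is at most [(rho / 4) ^ N * K / (rho / 2) ^ N =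
     K / 2 ^ N]. *)
  destruct (pow_lt_1_zero (/ 2)) with (y := eps / (K + 1)) as [N HN].
  { rewrite Rabs_pos_eq; lra. } { apply Rdiv_lt_0_compat; lra. }
  specialize (HN N (Nat.le_refl N)).
  assert (H2 : 0 < (/ 2) ^ N) by (apply pow_lt; lra).
  rewrite Rabs_pos_eq in HN by lra.
  destruct (least_nonzero c N) as [Hc|Hc]; [|now destruct Hno].
  rewrite (Hpow N Hc z Hz), Cmod_mult, Cmod_pow.
  pose proof (proj2 (proj2 (HT z Hz) N)) as HB.
  assert (Hr : 0 < (rho / 2) ^ N) by (apply pow_lt; lra).
  apply Rle_trans with ((rho / 4) ^ N * (K / (rho / 2) ^ N)).
  + apply Rmult_le_compat; trivial;
      [apply pow_le, Cmod_ge_0 | apply Cmod_ge_0 | apply pow_incr; split; trivial; apply Cmod_ge_0].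
  + replace (rho / 4) with (/ 2 * (rho / 2)) by field. rewrite Rpow_mult_distr.
    replace ((/ 2) ^ N * (rho / 2) ^ N * (K / (rho / 2) ^ N)) with ((/ 2) ^ N * K) by (field; lra).
    apply Rle_trans with (eps / (K + 1) * (K + 1)); [|apply Req_le; field; lra].
    apply Rmult_le_compat; lra.
Qed.

(** A leading coefficient [c] would satisfy [c + O(t) = 0] along the ray, hence vanish. *)
Lemma zero_on_ray_zero_on_disc (f : C -> C) (p w : C) (rho d : R) : 0 < rho -> 0 < d -> Cmod w = 1 ->
  (forall x, Cmod (x - p) < rho -> cdiff f x) ->
  (forall t, 0 < t < d -> f (p + t * w)%C = RtoC 0) ->
  forall z, Cmod z <= rho / 4 -> f (p + z)%C = RtoC 0.
Proof.
intros Hrho Hd Hw Hf H0.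
destruct (local_form f p rho Hrho Hf) as [H|(m & c & E & K & Hc & HK & H)]; trivial.
exfalso. apply Cmod_gt_0 in Hc.
enough (Cmod c <= 0) by lra.
apply (le_0_of_le_linear (Cmod c) K (Rmin d (rho / 4))); [apply Rmin_pos; lra|].
intros t Ht. pose proof (Rmin_l d (rho / 4)). pose proof (Rmin_r d (rho / 4)).
assert (Hm : Cmod (t * w)%C = t) by (apply Cmod_unit_scal; lra).
destruct (H (t * w)%C ltac:(lra)) as [E1 E2].
rewrite H0 in E1 by lra.
assert (Hnz : (t * w)%C <> RtoC 0) by (apply Cmod_gt_0; lra).
assert (E3 : (c + t * w * E (t * w))%C = RtoC 0).
{ apply NNPP. intros Hn. apply (Cmult_neq_0 _ _ (Cpow_nz _ m Hnz) Hn). now symmetry. }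
replace c with (- (t * w * E (t * w)))%C.
- rewrite Cmod_opp, Cmod_mult, Hm, Rmult_comm. apply Rmult_le_compat_r; lra.
- transitivity (c - (c + t * w * E (t * w)))%C; [ring|]. rewrite E3. ring.
Qed.

Lemma strip_disc (z w : C) : in_strip z -> Cmod (w - z) < 1 - Rabs (Im z) -> in_strip w.
Proof.
intros Hz Hw. unfold in_strip in *.
pose proof (im_le_Cmod (w - z)) as H.
pose proof (Rabs_triang (Im z) (Im (w - z))) as H'.
replace (Im z + Im (w - z)) with (Im w) in H' by (destruct w, z; unfold Im; simpl; ring).
lra.
Qed.

(** A chain of discs along the segment from [a] to [z]. Since [a] is real, no point of the segment
    is closer to the boundary than [z], so one radius [d] serves all discs. *)
Lemma strip_identity (F : C -> C) (a d0 : R) : 0 < d0 ->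
  (forall z, in_strip z -> cdiff F z) ->
  (forall t, 0 < t < d0 -> F (a + t)%C = RtoC 0) ->
  forall z, in_strip z -> F z = RtoC 0.
Proof.
intros Hd0 HF H0 z Hz.
set (d := 1 - Rabs (Im z)). assert (Hd : 0 < d) by (unfold d; unfold in_strip in Hz; lra).
set (L := Cmod (z - a)). assert (HL : 0 <= L) by apply Cmod_ge_0.
set (gam s := (RtoC a + RtoC s * (z - a))%C).
assert (Hdisc : forall s, 0 <= s <= 1 -> forall w, Cmod (w - gam s) < d -> cdiff F w).
{ intros s Hs w Hw. apply HF.
  assert (Him : Rabs (Im (gam s)) <= Rabs (Im z)).
  { replace (Im (gam s)) with (s * Im z) by (destruct z; unfold gam, Im; simpl; ring).
    rewrite Rabs_mult, (Rabs_pos_eq s) by lra. pose proof (Rabs_pos (Im z)). nra. }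
  apply (strip_disc (gam s)); unfold in_strip in *; unfold d in Hw; lra. }
destruct (INR_unbounded (8 * L / d)) as [n Hn].
assert (Hnpos : 0 < INR n).
{ eapply Rle_lt_trans; [|apply Hn]. apply Rdiv_le_0_compat; lra. }
assert (Hstep : L / INR n < d / 8).
{ apply (Rmult_lt_reg_r (INR n)); trivial.
  replace (L / INR n * INR n) with (d / 8 * (8 * L / d)) by (field; lra).
  apply Rmult_lt_compat_l; lra. }
assert (Hind : forall k, (k <= n)%nat ->
  forall x, Cmod x <= d / 4 -> F (gam (INR k / INR n)%R + x)%C = RtoC 0).
{ assert (Hk01 : forall k, (k <= n)%nat -> 0 <= INR k / INR n <= 1).
  { intros k Hk. apply le_INR in Hk. pose proof (pos_INR k). split.
    - apply Rdiv_le_0_compat; lra.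
    - apply (Rmult_le_reg_r (INR n)); trivial. unfold Rdiv. rewrite Rmult_assoc, Rinv_l; lra. }
  induction k as [|k IH]; intros Hk.
  - apply (zero_on_ray_zero_on_disc F _ (RtoC 1) d d0); trivial; [apply Cmod_1| |].
    + apply Hdisc. now apply Hk01.
    + intros t Ht. rewrite <- (H0 t Ht). f_equal. unfold gam. simpl INR.
      replace (0 / INR n) with 0 by (field; lra). ring.
  - apply (zero_on_ray_zero_on_disc F _ (RtoC 1) d (d / 8)); trivial; [lra|apply Cmod_1| |].
    + apply Hdisc. now apply Hk01.
    + intros t Ht.
      assert (E : gam (INR (S k) / INR n)%R = (gam (INR k / INR n)%R + RtoC (/ INR n) * (z - a))%C).
      { unfold gam. rewrite S_INR.
        replace ((INR k + 1) / INR n) with (INR k / INR n + / INR n) by (field; lra).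
        rewrite RtoC_plus. ring. }
      (* Centres are less than [d / 8] apart, so a ray of length [d / 8] from the new centre lies in
         the previous disc of radius [d / 4]. *)
      rewrite E, <- Cplus_assoc. apply IH; [lia|].
      eapply Rle_trans; [apply Cmod_triangle|].
      rewrite (Cmod_unit_scal t (RtoC 1)), Cmod_mult, Cmod_R by (try apply Cmod_1; lra).
      fold L. rewrite Rabs_pos_eq by (left; now apply Rinv_0_lt_compat).
      unfold Rdiv in Hstep. lra. }
specialize (Hind n (Nat.le_refl n) (RtoC 0)).
replace (gam (INR n / INR n)%R + 0)%C with z in Hind.
- apply Hind. rewrite Cmod_0. lra.
- unfold gam. replace (INR n / INR n) with 1 by (field; lra). ring.
Qed.

(** * Comparing moduli along a ray *)

Lemma equal_modulus_order_le (A B : C) (m n : nat) (K d : R) (e1 e2 : R -> C) :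
  0 < d <= 1 -> 0 <= K -> A <> RtoC 0 ->
  (forall t, 0 < t < d -> t ^ m * Cmod (A + t * e1 t) = t ^ n * Cmod (B + t * e2 t)) ->
  (forall t, 0 < t < d -> Cmod (e1 t) <= K /\ Cmod (e2 t) <= K) -> (n <= m)%nat.
Proof.
intros Hd HK HA HE Hb. apply Nat.nlt_ge. intros Hmn. apply Cmod_gt_0 in HA.
enough (Cmod A <= 0) by lra.
apply (le_0_of_le_linear _ (K + (Cmod B + K)) d); [lra|]. intros t Ht.
destruct (Hb t Ht) as [H1 H2]. specialize (HE t Ht).
(* Exposes at least one factor [t] on the right after division by [t ^ m], which forces [A] to be
   zero. *)
replace n with (m + S (n - m - 1))%nat in HE by lia.
rewrite pow_add, Rmult_assoc in HE. apply Rmult_eq_reg_l in HE; [|apply pow_nonzero; lra].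
assert (HB : Cmod (B + t * e2 t) <= Cmod B + K).
{ eapply Rle_trans; [apply Cmod_triangle|]. rewrite Cmod_mult, Cmod_R, Rabs_pos_eq by lra.
  pose proof (Cmod_ge_0 (e2 t)). nra. }
assert (Hp : t ^ S (n - m - 1) <= t).
{ simpl. rewrite <- (Rmult_1_r t) at 3. apply Rmult_le_compat_l; [lra|].
  rewrite <- (pow1 (n - m - 1)). apply pow_incr. lra. }
assert (HAe : Cmod A <= Cmod (A + t * e1 t) + K * t).
{ replace A with (A + t * e1 t - t * e1 t)%C at 1 by ring.
  eapply Rle_trans; [apply Cmod_triangle|]. rewrite Cmod_opp, Cmod_mult, Cmod_R, Rabs_pos_eq by lra.
  pose proof (Cmod_ge_0 (e1 t)). nra. }
assert (t ^ S (n - m - 1) * Cmod (B + t * e2 t) <= t * (Cmod B + K)).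
{ apply Rmult_le_compat; trivial; [apply pow_le; lra|apply Cmod_ge_0]. }
lra.
Qed.

Lemma equal_modulus_leading_le (A B : C) (m : nat) (K d : R) (e1 e2 : R -> C) :
  0 < d <= 1 -> 0 <= K ->
  (forall t, 0 < t < d -> t ^ m * Cmod (A + t * e1 t) = t ^ m * Cmod (B + t * e2 t)) ->
  (forall t, 0 < t < d -> Cmod (e1 t) <= K /\ Cmod (e2 t) <= K) -> Cmod A <= Cmod B.
Proof.
intros Hd HK HE Hb.
enough (Cmod A - Cmod B <= 0) by lra.
apply (le_0_of_le_linear _ (2 * K) d); [lra|]. intros t Ht.
destruct (Hb t Ht) as [H1 H2]. specialize (HE t Ht).
apply Rmult_eq_reg_l in HE; [|apply pow_nonzero; lra].
assert (HB : Cmod (B + t * e2 t) <= Cmod B + K * t).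
{ eapply Rle_trans; [apply Cmod_triangle|]. rewrite Cmod_mult, Cmod_R, Rabs_pos_eq by lra.
  pose proof (Cmod_ge_0 (e2 t)). nra. }
assert (HAe : Cmod A <= Cmod (A + t * e1 t) + K * t).
{ replace A with (A + t * e1 t - t * e1 t)%C at 1 by ring.
  eapply Rle_trans; [apply Cmod_triangle|]. rewrite Cmod_opp, Cmod_mult, Cmod_R, Rabs_pos_eq by lra.
  pose proof (Cmod_ge_0 (e1 t)). nra. }
lra.
Qed.

Lemma Cmod2_plus (X W : C) :
  Cmod (X + W)%C ^ 2 = Cmod X ^ 2 + 2 * Re (Cconj X * W)%C + Cmod W ^ 2.
Proof. rewrite !Cmod2_alt. destruct X, W; unfold Re, Im; simpl. ring. Qed.

(* Compare the terms of order [t^k] in [|X + (t w)^k Y|^2 = |X|^2]. *)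
Lemma leading_cross_term (X0 Y0 w : C) (k : nat) (X Y : R -> C) (K d : R) :
  0 < d <= 1 -> 0 <= K -> (0 < k)%nat -> Cmod w = 1 ->
  (forall t, 0 < t < d -> Cmod (X t + (t * w) ^ k * Y t)%C = Cmod (X t)) ->
  (forall t, 0 < t < d -> Cmod (X t - X0)%C <= K * t /\ Cmod (Y t - Y0)%C <= K * t) ->
  Re (Cconj X0 * (w ^ k * Y0))%C = 0.
Proof.
intros Hd HK Hk Hw HE Hb.
set (r := Re (Cconj X0 * (w ^ k * Y0))%C).
enough (Rabs r <= 0) by (apply Rabs_eq_0; pose proof (Rabs_pos r); lra).
apply (le_0_of_le_linear _ ((Cmod Y0 + K) ^ 2 + (Cmod X0 * K + K * (Cmod Y0 + K))) d); [lra|].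
intros t Ht. destruct (Hb t Ht) as [H1 H2]. specialize (HE t Ht).
assert (Hwk : Cmod (w ^ k)%C = 1) by (rewrite Cmod_pow, Hw; apply pow1).
assert (HY : Cmod (Y t) <= Cmod Y0 + K).
{ pose proof (Cmod_reverse_triangle (Y t) Y0). nra. }
pose proof (Cmod_ge_0 (Y t)) as Yp. pose proof (Cmod_ge_0 Y0) as Y0p. pose proof (Cmod_ge_0 X0) as X0p.
assert (Htk : 0 < t ^ k) by (apply pow_lt; lra).
(* Here [0 < k] matters: the squared term must vanish with [t]. *)
assert (Htk' : t ^ k <= t).
{ destruct k as [|k]; [lia|]. simpl. rewrite <- (Rmult_1_r t) at 3. apply Rmult_le_compat_l; [lra|].
  rewrite <- (pow1 k). apply pow_incr. lra. }
(* Expand the square, cancel [Cmod (X t) ^ 2] and divide by [t ^ k]. *)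
assert (E2 : 2 * Re (Cconj (X t) * (w ^ k * Y t))%C = - (t ^ k * Cmod (Y t) ^ 2)).
{ pose proof (Cmod2_plus (X t) ((t * w) ^ k * Y t)%C) as E. rewrite HE in E.
  rewrite Cpow_mult_l, <- RtoC_pow in E.
  rewrite !Cmod_mult, Cmod_R, Hwk, Rabs_pos_eq in E by lra.
  replace (Cconj (X t) * (RtoC (t ^ k) * w ^ k * Y t))%C
    with (RtoC (t ^ k) * (Cconj (X t) * (w ^ k * Y t)))%C in E by ring.
  rewrite re_scal_l in E.
  apply (Rmult_eq_reg_l (t ^ k)); [|lra]. lra. }
assert (Hcross : Rabs (r - Re (Cconj (X t) * (w ^ k * Y t))%C) <= (Cmod X0 * K + K * (Cmod Y0 + K)) * t).
{ replace (r - Re (Cconj (X t) * (w ^ k * Y t))%C) with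
    (Re (- (Cconj X0 * (w ^ k * (Y t - Y0)) + Cconj (X t - X0) * (w ^ k * Y t)))%C).
  2:{ unfold r. rewrite Cminus_conj. set (W := (w ^ k)%C).
      destruct X0, Y0, (X t), (Y t), W; unfold Re; simpl; ring. }
  eapply Rle_trans; [apply re_le_Cmod|]. rewrite Cmod_opp.
  eapply Rle_trans; [apply Cmod_triangle|].
  rewrite !Cmod_mult, !Cmod_conj, Hwk, !Rmult_1_l.
  assert (Cmod X0 * Cmod (Y t - Y0) <= Cmod X0 * (K * t)) by (apply Rmult_le_compat_l; lra).
  assert (Cmod (X t - X0) * Cmod (Y t) <= K * t * (Cmod Y0 + K))
    by (apply Rmult_le_compat; trivial; apply Cmod_ge_0).
  lra. }
assert (Hsq : t ^ k * Cmod (Y t) ^ 2 <= t * (Cmod Y0 + K) ^ 2).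
{ apply Rmult_le_compat; trivial; [lra|apply pow2_ge_0|]. apply pow_incr. lra. }
assert (Hsq0 : 0 <= t ^ k * Cmod (Y t) ^ 2) by (apply Rmult_le_pos; [lra|apply pow2_ge_0]).
apply Rabs_le_between in Hcross. apply Rabs_le. lra.
Qed.

(** * Powers on the unit circle and rational angles *)

Lemma cos_sin_pow (theta : R) (k : nat) :
  (((cos theta, sin theta) : C) ^ k)%C = (cos (INR k * theta), sin (INR k * theta)).
Proof.
induction k as [|k IH].
- simpl. now rewrite Rmult_0_l, cos_0, sin_0.
- rewrite Cpow_S, IH, S_INR. replace ((INR k + 1) * theta) with (theta + INR k * theta) by ring.
  rewrite cos_plus, sin_plus. unfold Cmult; simpl. f_equal; ring.
Qed.

Lemma sin_multiple_eq_0_rational (theta : R) (k : nat) : (0 < k)%nat ->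
  sin (INR k * theta) = 0 -> exists q : Q, theta = PI * Q2R q.
Proof.
intros Hk Hs. destruct (sin_eq_0_0 _ Hs) as [n Hn].
assert (HK : 0 < INR k) by (now apply lt_0_INR).
exists (n # Pos.of_nat k)%Q. unfold Q2R; simpl.
replace (IZR (Z.pos (Pos.of_nat k))) with (INR k).
- apply (Rmult_eq_reg_l (INR k)); [|lra]. rewrite Hn. field. lra.
- rewrite INR_IZR_INZ. f_equal. lia.
Qed.

Lemma Cmod_cos_sin (theta : R) : Cmod (cos theta, sin theta) = 1.
Proof.
transitivity (Cmod (cexp (0, theta))); [|rewrite Cmod_cexp; exact exp_0].
f_equal. unfold cexp, Re, Im; simpl.
rewrite exp_0. f_equal; ring.
Qed.

(** * Rigidity from two lines at an irrational angle *)

Theorem theorem4p5 (f g : C -> C) (a theta : R) :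
  H2tau f -> H2tau g ->
  (forall x : R, Cmod (g (RtoC x)) = Cmod (f (RtoC x))) ->
  (forall t : R, -1 < t < 1 ->
     Cmod (g (a + t * cos theta, t * sin theta)) =
     Cmod (f (a + t * cos theta, t * sin theta))) ->
  (~ exists q : Q, theta = PI * Q2R q) ->
  exists c : C, Cmod c = 1 /\ forall z : C, in_strip z -> g z = (c * f z)%C.
Proof.
intros [Hf _] [Hg _] Hreal Hseg Hirr.
assert (Df : forall z, in_strip z -> cdiff f z).
{ intros z Hz. destruct (Hf z Hz) as [l Hl]. exact (is_derive_cdiff f z l Hl). }
assert (Dg : forall z, in_strip z -> cdiff g z).
{ intros z Hz. destruct (Hg z Hz) as [l Hl]. exact (is_derive_cdiff g z l Hl). }
clear Hf Hg.
assert (Hstrip : forall w, Cmod (w - RtoC a) < 1 -> in_strip w).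
{ intros w Hw. apply (strip_disc (RtoC a)); unfold in_strip, Im; simpl; rewrite Rabs_R0; lra. }
assert (Hreal' : forall t : R, Cmod (g (a + t)%C) = Cmod (f (a + t)%C))
  by (intros t; rewrite <- RtoC_plus; apply Hreal).
assert (Hzero : forall h : C -> C, (forall z, in_strip z -> cdiff h z) ->
  (forall t, 0 < t < 1 / 4 -> Cmod (h (a + t)%C) = 0) -> forall z, in_strip z -> h z = RtoC 0).
{ intros h Dh Hh. apply (strip_identity h a (1 / 4)); trivial; [lra|].
  intros t Ht. apply Cmod_eq_0. auto. }
assert (Hsmall : forall t, 0 < t < 1 / 4 -> Cmod (RtoC t) <= 1 / 4)
  by (intros t Ht; rewrite Cmod_R, Rabs_pos_eq; lra).
(* Degenerate case: if one function vanishes near [a], equal moduli on the real line make both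
   vanish, and any unimodular constant works. *)
assert (Hboth : (forall t, 0 < t < 1 / 4 -> Cmod (f (a + t)%C) = 0) ->
  exists c : C, Cmod c = 1 /\ forall z : C, in_strip z -> g z = (c * f z)%C).
{ intros H0. exists (RtoC 1). split; [apply Cmod_1|]. intros z Hz.
  rewrite (Hzero f Df H0 z Hz), (Hzero g Dg); trivial; [ring|].
  intros t Ht. rewrite Hreal'. auto. }
(* The unit disc around the real point [a] lies in the strip, whence the range [1 / 4]
   throughout. *)
destruct (local_form f (RtoC a) 1) as [H|(m & A & E1 & K1 & HA & HK1 & H1)]; [lra|auto| |].
{ apply Hboth. intros t Ht. rewrite H by auto. apply Cmod_0. }
destruct (local_form g (RtoC a) 1) as [H|(n & B & E2 & K2 & HB & HK2 & H2)]; [lra|auto| |].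
{ apply Hboth. intros t Ht. rewrite <- Hreal', H by auto. apply Cmod_0. }
assert (Hmod : forall t, 0 < t < 1 / 4 ->
  t ^ m * Cmod (A + t * E1 (RtoC t)) = t ^ n * Cmod (B + t * E2 (RtoC t))).
{ intros t Ht. specialize (Hreal' t).
  rewrite (proj1 (H1 t (Hsmall t Ht))), (proj1 (H2 t (Hsmall t Ht))) in Hreal'.
  rewrite !(Cmod_mult (_ ^ _)), !Cmod_pow, Cmod_R, Rabs_pos_eq in Hreal' by lra. now symmetry. }
assert (HbE : forall t, 0 < t < 1 / 4 -> Cmod (E1 (RtoC t)) <= K1 + K2 /\ Cmod (E2 (RtoC t)) <= K1 + K2).
{ intros t Ht. pose proof (proj2 (H1 t (Hsmall t Ht))). pose proof (proj2 (H2 t (Hsmall t Ht))). lra. }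
assert (Emn : m = n).
{ apply Nat.le_antisymm.
  - apply (equal_modulus_order_le B A n m (K1 + K2) (1 / 4) (fun t => E2 (RtoC t)) (fun t => E1 (RtoC t)));
      trivial; try lra; intros t Ht; [symmetry; auto|]. destruct (HbE t Ht); auto.
  - apply (equal_modulus_order_le A B m n (K1 + K2) (1 / 4) (fun t => E1 (RtoC t)) (fun t => E2 (RtoC t)));
      trivial; lra. }
subst n.
assert (EAB : Cmod A = Cmod B).
{ apply Rle_antisym.
  - apply (equal_modulus_leading_le A B m (K1 + K2) (1 / 4) (fun t => E1 (RtoC t)) (fun t => E2 (RtoC t)));
      trivial; lra.
  - apply (equal_modulus_leading_le B A m (K1 + K2) (1 / 4) (fun t => E2 (RtoC t)) (fun t => E1 (RtoC t)));
      trivial; try lra; intros t Ht; [symmetry; auto|]. destruct (HbE t Ht); auto. }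
set (c := (B / A)%C).
assert (HAp : 0 < Cmod A) by now apply Cmod_gt_0.
assert (Hc : Cmod c = 1).
{ unfold c. rewrite Cmod_div, EAB by trivial. apply Rinv_r. lra. }
assert (HcA : (c * A)%C = B) by (unfold c; field; trivial).
exists c. split; trivial.
set (F := fun z => (g z - c * f z)%C).
assert (DF : forall z, in_strip z -> cdiff F z).
{ intros z Hz. apply cdiff_minus; auto. apply cdiff_mult; auto. apply cdiff_const. }
enough (HF0 : forall z, in_strip z -> F z = RtoC 0).
{ intros z Hz. apply Ceq_minus. now apply HF0. }
destruct (local_form F (RtoC a) 1) as [H|(j & D & E3 & K3 & HD & HK3 & H3)]; [lra|auto| |].
{ apply Hzero; trivial. intros t Ht. rewrite H by auto. apply Cmod_0. }
exfalso.
(* As [c * A = B], the terms of order [m] cancel in [F]. If [j <= m], dividing by [t ^ j] would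
   leave [D = O(t)]. *)
assert (Hjm : (m < j)%nat).
{ apply Nat.nle_gt. intros Hle. pose proof HD as HDp. apply Cmod_gt_0 in HDp.
  enough (Cmod D <= 0) by lra.
  apply (le_0_of_le_linear _ (K3 + (K2 + K1)) (1 / 4)); [lra|]. intros t Ht.
  assert (Hts := Hsmall t Ht).
  destruct (H1 t Hts) as [F1 B1]. destruct (H2 t Hts) as [F2 B2]. destruct (H3 t Hts) as [F3 B3].
  unfold F in F3. rewrite F1, F2 in F3.
  assert (Htz : RtoC t <> RtoC 0) by (intros E; apply RtoC_inj in E; lra).
  assert (Hpz := Cpow_nz _ j Htz).
  assert (E : (D + t * E3 t)%C = (t ^ (m - j) * (t * (E2 t - c * E1 t)))%C).
  { transitivity ((t ^ j * (D + t * E3 t)) / t ^ j)%C; [field; trivial|]. rewrite <- F3.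
    replace m with (j + (m - j))%nat at 1 2 by lia. rewrite Cpow_add_r, <- HcA. field. trivial. }
  replace D with ((D + t * E3 t) - t * E3 t)%C by ring. rewrite E.
  eapply Rle_trans; [apply Cmod_triangle|].
  rewrite Cmod_opp, !Cmod_mult, Cmod_pow, Cmod_R, Rabs_pos_eq by lra.
  assert (Hd2 : Cmod (E2 t - c * E1 t) <= K2 + K1).
  { eapply Rle_trans; [apply Cmod_triangle|]. rewrite Cmod_opp, Cmod_mult, Hc. lra. }
  assert (Hp1 : t ^ (m - j) <= 1) by (rewrite <- (pow1 (m - j)); apply pow_incr; lra).
  assert (Hp0 : 0 <= t ^ (m - j)) by (apply pow_le; lra).
  assert (t * Cmod (E3 t) <= t * K3) by (apply Rmult_le_compat_l; lra).
  assert (t ^ (m - j) * (t * Cmod (E2 t - c * E1 t)) <= 1 * (t * (K2 + K1))).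
  { pose proof (Cmod_ge_0 (E2 t - c * E1 t)).
    apply Rmult_le_compat; trivial; [apply Rmult_le_pos; lra|]. apply Rmult_le_compat_l; lra. }
  lra. }
set (k := (j - m)%nat).
(* After division by [z ^ m], [c * f] becomes [X] with limit [B] and [F] becomes [z ^ k * Y] with
   [Y] tending to [D]. Since [Cmod c = 1], equal moduli of [f] and [g] say that adding [z ^ k * Y]
   keeps the modulus of [X]. *)
assert (Hcross : forall w, Cmod w = 1 ->
  (forall t, 0 < t < 1 / 4 -> Cmod (g (a + t * w)%C) = Cmod (f (a + t * w)%C)) ->
  Re (Cconj B * (w ^ k * D))%C = 0).
{ intros w Hw Hgf.
  apply (leading_cross_term B D w k
    (fun t => c * (A + (t * w) * E1 (t * w)%C))%C (fun t => D + (t * w) * E3 (t * w)%C)%C (K1 + K3) (1 / 4));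
    [lra|lra|unfold k; lia|trivial| |].
  - intros t Ht.
    assert (Hm : Cmod (t * w)%C = t) by (apply Cmod_unit_scal; lra).
    assert (Hts : Cmod (t * w)%C <= 1 / 4) by lra.
    specialize (Hgf t Ht).
    destruct (H1 _ Hts) as [F1 _]. destruct (H3 _ Hts) as [F3 _].
    set (z := (t * w)%C) in *.
    assert (Hz : 0 < Cmod (z ^ m)%C) by (rewrite Cmod_pow, Hm; apply pow_lt; lra).
    apply (Rmult_eq_reg_l (Cmod (z ^ m)%C)); [|lra].
    rewrite <- !Cmod_mult.
    transitivity (Cmod (g (a + z)%C)).
    + f_equal. transitivity (c * f (a + z)%C + F (a + z)%C)%C; [|unfold F; ring].
      rewrite F1, F3. replace j with (m + k)%nat by (unfold k; lia). rewrite Cpow_add_r. ring.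
    + rewrite Hgf, F1, !Cmod_mult, Hc. ring.
  - intros t Ht.
    assert (Hm : Cmod (t * w)%C = t) by (apply Cmod_unit_scal; lra).
    assert (Hts : Cmod (t * w)%C <= 1 / 4) by lra.
    destruct (H1 _ Hts) as [_ B1]. destruct (H3 _ Hts) as [_ B3].
    set (z := (t * w)%C) in *. split.
    + replace (c * (A + z * E1 z) - B)%C with (c * (z * E1 z))%C by (rewrite <- HcA; ring).
      rewrite !Cmod_mult, Hc, Hm. nra.
    + replace (D + z * E3 z - D)%C with (z * E3 z)%C by ring. rewrite Cmod_mult, Hm. nra. }
set (e := (Cconj B * D)%C).
assert (He : e <> RtoC 0).
{ apply Cmult_neq_0; trivial. apply Cmod_gt_0. rewrite Cmod_conj. lra. }
assert (Hre : Re e = 0).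
{ rewrite <- (Hcross (RtoC 1)); [|apply Cmod_1|intros t Ht; rewrite Cmult_1_r; apply Hreal'].
  f_equal. rewrite Cpow_1_l. unfold e. ring. }
assert (Hth : Re (Cconj B * (((cos theta, sin theta) : C) ^ k * D))%C = 0).
{ apply Hcross; [apply Cmod_cos_sin|]. intros t Ht.
  replace (a + t * ((cos theta, sin theta) : C))%C with ((a + t * cos theta, t * sin theta) : C).
  - apply Hseg. lra.
  - unfold Cplus, Cmult, RtoC; simpl. f_equal; ring. }
rewrite cos_sin_pow in Hth.
replace (Cconj B * ((cos (INR k * theta), sin (INR k * theta)) * D))%C
  with (e * (cos (INR k * theta), sin (INR k * theta)))%C in Hth by (unfold e; ring).
clearbody e. rewrite re_mult, Hre in Hth. unfold Re, Im in Hth; simpl in Hth.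
apply Hirr, (sin_multiple_eq_0_rational theta k); [unfold k; lia|].
(* With [Re e = 0], the equation [Hth] has become [- Im e * sin (k theta) = 0]. *)
assert (Him : Im e <> 0).
{ intros Hi. apply He. rewrite (surjective_pairing e). exact (f_equal2 pair Hre Hi). }
unfold Im in Him. apply (Rmult_eq_reg_l (snd e)); [|exact Him]. lra.
Qed.
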